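(* The emptiness problem on $\mathsf{DREL}_{\mathtt{test}}$ (resp. on $\mathsf{DREL}^{\mathrm{fin}}_{\mathtt{test}}$) is $\Pi^0_1$-complete for $\mathrm{PWP}_{\circlearrowleft}$ terms in which at most $4$ actions and exactly $1$ primitive test occur.
   Context: Fix disjoint countably infinite sets $\mathbf{P}$ (primitive tests) and $\mathbf{A}$ (actions) of variables, with a fixpoint-free involution $p\mapsto\tilde p$ on $\mathbf{P}$. The number of primitive tests of a term counts involution pairs $\{p,\tilde p\}$ (e.g. $p;\tilde p;q$ has 2). Terms are built from variables and constants $\mathrm{I}$, $0$ using binary $;$, $+$, $\cap$ and unary ${}^*$; $t^{\circlearrowleft}:=t\cap\mathrm{I}$. A valuation $v$ over a nonempty set $B$ assigns to each variable a binary relation on $B$, extended to terms by $\hat v(\mathrm{I})$ = identity on $B$, $\hat v(0)=\emptyset$, $;$ = composition, $+$ = union, $\cap$ = intersection, ${}^*$ = reflexive transitive closure. $\mathsf{DREL}_{\mathtt{test}}$ is the class of valuations (over any nonempty $B$) in which every variable denotes a partial function and, for $p\in\mathbf{P}$, $v(p)\subseteq$ identity and $v(\tilde p)=$ identity $\setminus v(p)$; $\mathsf{DREL}^{\mathrm{fin}}_{\mathtt{test}}$ restricts to finite $B$. Tests: smallest set containing $\mathbf{P},\mathrm{I},0$ closed under $;$, $+$; complement $\tilde b$: $\tilde{\mathrm{I}}=0$, $\tilde 0=\mathrm{I}$, $\widetilde{b+c}=\tilde b;\tilde c$, $\widetilde{b;c}=\tilde b+\tilde c$. $t+_bu:=b;t+\tilde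 b;u$, $t^{*_b}:=(b;t)^*;\tilde b$. $\mathrm{PWP}_{\circlearrowleft}$ terms: smallest set containing tests and actions, closed under $t;u$, $t+_bu$, $t^{*_b}$ ($b$ a test) and $t^{\circlearrowleft}$. The emptiness problem on a class $\mathcal{K}$: given $t$, decide whether $\hat v(t)=\emptyset$ for all $v\in\mathcal{K}$. *)

(* Defs.v *)
From mathcomp Require Import all_boot.
From Stdlib Require Import Relation_Operators.
Set Implicit Arguments.
Unset Strict Implicit.
Unset Printing Implicit Defensive.

(* Kleene's total recursive functions: the least class of total functions on
   natural numbers containing the initial functions and closed under
   composition, primitive recursion on the first argument, and minimization of
   regular functions (in [rec_min], the hypothesis says that h x is the least
   zero of f (-, x), so that the minimum exists for every x).
   [rec_ext] only states that the class is one of extensional functions. *)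
Inductive recursive : forall n : nat, (n.-tuple nat -> nat) -> Prop :=
| rec_zero n : recursive (fun _ : n.-tuple nat => 0)
| rec_succ : recursive (fun x : 1.-tuple nat => (thead x).+1)
| rec_proj n (i : 'I_n) : recursive (fun x : n.-tuple nat => tnth x i)
| rec_comp m n (f : m.-tuple nat -> nat) (g : 'I_m -> n.-tuple nat -> nat) :
    recursive f -> (forall i, recursive (g i)) ->
    recursive (fun x : n.-tuple nat => f [tuple g i x | i < m])
| rec_prim n (f : n.-tuple nat -> nat) (g : n.+2.-tuple nat -> nat) :
    recursive f -> recursive g ->
    recursive (fun x : n.+1.-tuple nat =>
      let y : n.-tuple nat := [tuple of behead x] in
      iteri (thead x) (fun k r => g [tuple of [:: k, r & y]]) (f y))
| rec_min n (f : n.+1.-tuple nat -> nat) (h : n.-tuple nat -> nat) :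
    recursive f ->
    (forall x : n.-tuple nat, f [tuple of h x :: x] = 0 /\
       forall k, k < h x -> f [tuple of k :: x] <> 0) ->
    recursive h
| rec_ext n (f g : n.-tuple nat -> nat) :
    f =1 g -> recursive f -> recursive g.

(* Recursive relations are represented as zero sets of recursive functions. *)
Definition Pi01 (P : nat -> Prop) : Prop :=
  exists2 R : 2.-tuple nat -> nat, recursive R &
    forall x, P x <-> forall y, R [tuple x; y] = 0.

Definition many_one_reducible (Q P : nat -> Prop) : Prop :=
  exists2 f : 1.-tuple nat -> nat, recursive f &
    forall x, Q x <-> P (f [tuple x]).

Definition Pi01_complete (P : nat -> Prop) : Prop :=
  Pi01 P /\ forall Q, Pi01 Q -> many_one_reducible Q P.

(* The primitive tests are (i, true) and (i, false) for i : nat, exchanged by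
   the involution; i thus identifies the pair {p, ~p}. *)
Definition ptest : Type := (nat * bool)%type.
Definition ptest_compl (p : ptest) : ptest := (p.1, ~~ p.2).

Definition action : Type := nat.

Inductive var := PTest of ptest | Action of action.

Inductive term :=
| TVar of var
| TI
| T0
| TSeq of term & term
| TPlus of term & term
| TCap of term & term
| TStar of term.

Definition tloop (t : term) : term := TCap t TI.

Inductive is_test : term -> Prop :=
| test_prim p : is_test (TVar (PTest p))
| test_I : is_test TI
| test_0 : is_test T0
| test_seq b c : is_test b -> is_test c -> is_test (TSeq b c)
| test_plus b c : is_test b -> is_test c -> is_test (TPlus b c).

(* Only meaningful on tests; the value on other terms is junk. *)
Fixpoint test_compl (b : term) : term :=
  match b with
  | TVar (PTest p) => TVar (PTest (ptest_compl p))
  | TI => T0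
  | T0 => TI
  | TPlus b c => TSeq (test_compl b) (test_compl c)
  | TSeq b c => TPlus (test_compl b) (test_compl c)
  | _ => b
  end.

Definition tif (b t u : term) : term :=
  TPlus (TSeq b t) (TSeq (test_compl b) u).

Definition twhile (b t : term) : term :=
  TSeq (TStar (TSeq b t)) (test_compl b).

Inductive PWP_loop : term -> Prop :=
| PWP_test b : is_test b -> PWP_loop b
| PWP_action a : PWP_loop (TVar (Action a))
| PWP_seq t u : PWP_loop t -> PWP_loop u -> PWP_loop (TSeq t u)
| PWP_if b t u :
    is_test b -> PWP_loop t -> PWP_loop u -> PWP_loop (tif b t u)
| PWP_while b t : is_test b -> PWP_loop t -> PWP_loop (twhile b t)
| PWP_tloop t : PWP_loop t -> PWP_loop (tloop t).

Fixpoint vars (t : term) : seq var :=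
  match t with
  | TVar x => [:: x]
  | TI | T0 => [::]
  | TSeq t u | TPlus t u | TCap t u => vars t ++ vars u
  | TStar t => vars t
  end.

Definition num_actions (t : term) : nat :=
  size (undup (pmap (fun x => if x is Action a then Some a else None)
                    (vars t))).

(* Counts the pairs {p, ~p}, not the elements of ptest. *)
Definition num_ptests (t : term) : nat :=
  size (undup (pmap (fun x => if x is PTest p then Some p.1 else None)
                    (vars t))).

Definition valuation (B : Type) : Type := var -> B -> B -> Prop.

Fixpoint eval (B : Type) (v : valuation B) (t : term) : B -> B -> Prop :=
  match t with
  | TVar x => v x
  | TI => fun a b => a = b
  | T0 => fun _ _ => False
  | TSeq t u => fun a b => exists2 c, eval v t a c & eval v u c b
  | TPlus t u => fun a b => eval v t a b \/ eval v u a b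
  | TCap t u => fun a b => eval v t a b /\ eval v u a b
  | TStar t => clos_refl_trans B (eval v t)
  end.

Definition vclass : Type := forall B : Type, valuation B -> Prop.

Definition DREL_test : vclass := fun B v =>
  [/\ inhabited B,
      forall x a b c, v x a b -> v x a c -> b = c,
      forall p a b, v (PTest p) a b -> a = b &
      forall p a b,
        v (PTest (ptest_compl p)) a b <-> a = b /\ ~ v (PTest p) a b].

Definition DREL_fin_test : vclass := fun B v =>
  DREL_test v /\ exists n (f : 'I_n -> B), bijective f.

Definition term_empty (K : vclass) (t : term) : Prop :=
  forall (B : Type) (v : valuation B), K B v -> forall a b, ~ eval v t a b.

(* Cantor pairing: (m + n)(m + n + 1)/2 + m. *)
Definition npair (m n : nat) : nat := 'C((m + n).+1, 2) + m.

Fixpoint term_code (t : term) : nat :=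
  match t with
  | TVar (PTest p) => npair 0 (p.1.*2 + p.2)
  | TVar (Action a) => npair 1 a
  | TI => npair 2 0
  | T0 => npair 3 0
  | TSeq t u => npair 4 (npair (term_code t) (term_code u))
  | TPlus t u => npair 5 (npair (term_code t) (term_code u))
  | TCap t u => npair 6 (npair (term_code t) (term_code u))
  | TStar t => npair 7 (term_code t)
  end.

Lemma npair_inj m n m' n' : npair m n = npair m' n' -> m = m' /\ n = n'.
Proof.
have lt_pair a b c d : a + b < c + d -> npair a b < npair c d.
  move=> lt_s; apply: (@leq_trans 'C((a + b).+2, 2)).
    by rewrite /npair [ltnRHS]binS bin1 ltn_add2l ltnS leq_addr.
  by apply: leq_trans (leq_addr _ _); apply: leq_bin2l.
move=> e; have es : m + n = m' + n'.
  by case: (ltngtP (m + n) (m' + n')) => // /lt_pair; rewrite e ltnn.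
move: e; rewrite /npair es => /addnI em; split=> //.
by move: es; rewrite em => /addnI.
Qed.

Lemma term_code_inj : injective term_code.
Proof.
have two (i j : nat) (b c : bool) :
    i.*2 + b = j.*2 + c -> (i, b) = (j, c).
  move=> e; have eb : b = c.
    by have /= := congr1 odd e; rewrite !oddD !odd_double !oddb.
  by move: e; rewrite eb => /addIn /double_inj ->.
elim=> [[[i b]|a]|||t IHt u IHu|t IHt u IHu|t IHt u IHu|t IHt]
  [[[j c]|d]|||t' u'|t' u'|t' u'|t'] //=
  /npair_inj [] // _; last by move/IHt ->.
- by move/two ->.
- by move=> ->.
all: by move/npair_inj=> [/IHt -> /IHu ->].
Qed.

(* Numbers that do not code a term in T are negative instances. *)
Definition emptiness_problem (K : vclass) (T : term -> Prop) : nat -> Prop :=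
  fun n => exists t : term, [/\ n = term_code t, T t & term_empty K t].

(* Main.v *)
Require Import Defs.
From mathcomp Require Import all_boot.
From mathcomp Require Import zify.
From mathcomp Require Import boolp.
From Stdlib Require Import Relation_Operators Operators_Properties.

(* Membership. A pair of points is related by a term iff this has a finite
   derivation, whose atomic steps use finitely many points; conversely, a finite
   derivation over natural numbers whose atoms are functional and whose tests are
   consistent yields a finite model. So nonemptiness is witnessed by a number, and
   it is the same for finite and for arbitrary valuations.

   Hardness. A run of a queue automaton is determined by the word of all the bits
   that ever enter the queue. Lay this word along a path of an action next, and
   let an action tail map the position of the head of the queue to the position
   of its end. A step reads the enqueued word w along next from the end of the
   queue, and must check that tail maps the next head to the end of w. Two more
   actions prev and head are used for this: the loops on head; tail and on
   prev; next force them to be inverse to tail and next where it matters. The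
   only test is the label of a position. Queue automata that never shrink their
   queue simulate counter programs, hence the search for y with R(x, y) <> 0. *)

(** Intersection is available only against the identity, so a term cannot compare the ends of two
    paths; it can only check that a walk comes back to its origin. A check that [tail] respects a
    step must therefore be a closed walk, and this walk needs ways back, hence an inverse for each
    of the two functions: four actions, whatever the program. Since the inverse of [tail] must
    itself be functional, two states may never share an end of queue. So every step enqueues a
    nonempty word, which is the origin of the restriction on the queue and the reason why a
    decrement has to store the removed unit somewhere. One test is enough because the alphabet is
    binary: registers are unary blocks, and all other data, the input included, sit in the text of
    the program. Determinism closes the argument. A terminating run is itself a finite model, and a
    pair related by the term in any model spells out a terminating run, so emptiness is
    divergence. *)

Set Implicit Arguments.
Unset Strict Implicit.
Unset Printing Implicit Defensive.

(** * Closure properties of the recursive functions *)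

(* Contexts are lists, so that bound variables can be added in front of them. *)
Definition rec n (f : seq nat -> nat) : Prop :=
  recursive (fun x : n.-tuple nat => f x).

Definition recb n (p : seq nat -> bool) : Prop :=
  rec n (fun s => nat_of_bool (p s)).

(** Phrased as closure under precomposition: the nested [drop]s that bound variables create then
    compose without any bookkeeping of components. *)
Definition recenv n m (e : seq nat -> seq nat) : Prop :=
  forall f, rec m f -> rec n (fun s => f (e s)).

Lemma rec_eq n f g :
  (forall s, size s = n -> f s = g s) -> rec n f -> rec n g.
Proof. by move=> e; apply: rec_ext => x; apply: e; rewrite size_tuple. Qed.

Lemma rec_var n i : i < n -> rec n (fun s => nth 0 s i).
Proof.
move=> lt_i; apply: rec_ext (rec_proj (Ordinal lt_i)) => x.
by rewrite (tnth_nth 0).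
Qed.

Lemma rec_subst n m f (g : 'I_m -> seq nat -> nat) :
  rec m f -> (forall i, rec n (g i)) ->
  rec n (fun s => f [seq g i s | i <- enum 'I_m]).
Proof. by move=> Rf Rg; apply: rec_ext (rec_comp Rf Rg). Qed.

Lemma recenv_id n : recenv n n (fun s => s).
Proof. by []. Qed.

Lemma recenv_drop k n m e :
  recenv n (k + m) e -> recenv n m (fun s => drop k (e s)).
Proof.
move=> Re f Rf; apply: (Re (fun s => f (drop k s))).
have /(rec_subst Rf) : forall i : 'I_m, rec (k + m) (fun s => nth 0 s (k + i)).
  by move=> i; apply: rec_var; rewrite ltn_add2l.
apply: rec_eq => s sz; congr f; apply: (@eq_from_nth _ 0) => [|i].
  by rewrite size_map size_enum_ord size_drop sz addKn.
rewrite size_map size_enum_ord => lt_i.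
by rewrite (nth_map (Ordinal lt_i)) ?size_enum_ord // nth_enum_ord // nth_drop.
Qed.

Lemma rec_succ1 n g : rec n g -> rec n (fun s => (g s).+1).
Proof.
move=> Rg.
apply: rec_ext (rec_comp (g := fun _ => fun x => g x) rec_succ (fun _ => Rg)).
by move=> x; rewrite /thead tnth_mktuple.
Qed.

Lemma rec_cst n c : rec n (fun _ => c).
Proof. by elim: c => [|c /rec_succ1]; first exact: rec_zero. Qed.

(** The index and the accumulator are the two variables pushed in front of the context, so the body
    finds its own context under [drop 2]. *)
Lemma rec_iteri n g f (h : seq nat -> nat -> nat -> nat) :
  rec n g -> rec n f ->
  rec n.+2 (fun s => h (drop 2 s) (nth 0 s 0) (nth 0 s 1)) ->
  rec n (fun s => iteri (g s) (h s) (f s)).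
Proof.
(* Primitive recursion counts on its first argument, so the bound [g s] is consed onto the
   context. *)
move=> Rg Rf Rh; pose e (i : 'I_n.+1) s := nth 0 (g s :: s) i.
have Re i : rec n (e i) by case: i => [[|i] lt_i] //; apply: rec_var.
have := rec_subst (f := fun s => iteri (nth 0 s 0) (h (behead s)) (f (behead s)))
  _ Re.
have es s : size s = n -> [seq e i s | i <- enum 'I_n.+1] = g s :: s.
  move=> sz; apply: (@eq_from_nth _ 0) => [|i].
    by rewrite size_map size_enum_ord /= sz.
  rewrite size_map size_enum_ord => lt_i.
  by rewrite (nth_map (Ordinal lt_i)) ?size_enum_ord // /e nth_enum_ord.
move=> R; apply: rec_eq (R _) => [s sz|]; first by rewrite es.
apply: rec_ext (rec_prim Rf Rh) => x.
case/tupleP: x => k x; rewrite theadE /=.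
by elim: (k) => //= j ->; rewrite drop0.
Qed.

Lemma rec_in_env n m e f :
  rec m f -> recenv n m e -> rec n (fun s => f (e s)).
Proof. by move=> Rf; apply. Qed.

Lemma recb_in_env n m e p :
  recb m p -> recenv n m e -> recb n (fun s => p (e s)).
Proof. by move=> Rp Re; apply: (rec_in_env Rp Re). Qed.

Lemma rec_var_in_env n m e i :
  recenv n m e -> i < m -> rec n (fun s => nth 0 (e s) i).
Proof. by move=> Re lt_i; apply: (rec_in_env (rec_var lt_i) Re). Qed.

Ltac rec_env := (repeat apply: recenv_drop); exact: recenv_id.

(** The pattern [@?e] captures the tower of [drop]s between the current context and the one in which
    a variable or a hypothesis was stated. *)
Ltac rec_base := match goal with
  | |- rec _ (fun s => nth 0 (@?e s) ?i) =>
    refine (rec_var_in_env (e := e) _ _); [rec_env | done]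
  | H : rec ?m ?g |- rec _ (fun s => ?g (@?e s)) =>
    apply: (rec_in_env (e := e) H); rec_env
  | H : recb ?m ?g |- recb _ (fun s => ?g (@?e s)) =>
    apply: (recb_in_env (e := e) H); rec_env
  end.

Create HintDb rec.
#[export] Hint Extern 0 (rec _ _) => rec_base : rec.
#[export] Hint Extern 0 (recb _ _) => rec_base : rec.

Ltac rec_tac := solve [auto 100 with rec].

Lemma rec_of_recb n p : recb n p -> rec n (fun s => nat_of_bool (p s)).
Proof. by []. Qed.

#[export] Hint Resolve rec_cst rec_succ1 rec_iteri rec_of_recb : rec.

Lemma rec_iter n g f (h : seq nat -> nat -> nat) :
  rec n g -> rec n f -> rec n.+2 (fun s => h (drop 2 s) (nth 0 s 1)) ->
  rec n (fun s => iter (g s) (h s) (f s)).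
Proof.
move=> Rg Rf Rh; have := rec_iteri (h := fun s _ => h s) Rg Rf Rh.
by apply: rec_eq => s _; elim: (g s) => //= k ->.
Qed.
#[export] Hint Resolve rec_iter : rec.

Lemma rec_pred n g : rec n g -> rec n (fun s => (g s).-1).
Proof.
move=> Rg; have: rec n (fun s => iteri (g s) (fun k _ => k) 0) by rec_tac.
by apply: rec_eq => s _; case: (g s).
Qed.
#[export] Hint Resolve rec_pred : rec.

Lemma rec_add n f g : rec n f -> rec n g -> rec n (fun s => f s + g s).
Proof.
move=> Rf Rg; have: rec n (fun s => iter (f s) succn (g s)) by rec_tac.
by apply: rec_eq => s _; elim: (f s) => //= k ->.
Qed.
#[export] Hint Resolve rec_add : rec.

Lemma rec_sub n f g : rec n f -> rec n g -> rec n (fun s => f s - g s).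
Proof.
move=> Rf Rg; have: rec n (fun s => iter (g s) predn (f s)) by rec_tac.
by apply: rec_eq => s _; elim: (g s) => [|k /= ->]; rewrite ?subn0 ?subnS.
Qed.
#[export] Hint Resolve rec_sub : rec.

Lemma recb_not n p : recb n p -> recb n (fun s => ~~ p s).
Proof.
move=> Rp; have: rec n (fun s => 1 - p s) by rec_tac.
by apply: rec_eq => s _; case: (p s).
Qed.
#[export] Hint Resolve recb_not : rec.

Lemma rec_if n p f g : recb n p -> rec n f -> rec n g ->
  rec n (fun s => if p s then f s else g s).
Proof.
move=> Rp Rf Rg.
have: rec n (fun s => iter (p s) (fun _ => f s) (g s)).
  by apply: rec_iter; rec_tac.
by apply: rec_eq => s _; case: (p s).
Qed.
#[export] Hint Resolve rec_if : rec.

Lemma recb_cst n b : recb n (fun _ => b).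
Proof. exact: rec_cst. Qed.
#[export] Hint Resolve recb_cst : rec.

Lemma recb_and n p q : recb n p -> recb n q -> recb n (fun s => p s && q s).
Proof.
move=> Rp Rq; have: rec n (fun s => if p s then nat_of_bool (q s) else 0) by rec_tac.
by apply: rec_eq => s _; case: (p s).
Qed.

Lemma recb_or n p q : recb n p -> recb n q -> recb n (fun s => p s || q s).
Proof.
move=> Rp Rq; have: rec n (fun s => if p s then 1 else nat_of_bool (q s)) by rec_tac.
by apply: rec_eq => s _; case: (p s).
Qed.

Lemma recb_imp n p q : recb n p -> recb n q -> recb n (fun s => p s ==> q s).
Proof.
move=> Rp Rq; have: rec n (fun s => if p s then nat_of_bool (q s) else 1) by rec_tac.
by apply: rec_eq => s _; case: (p s).
Qed.

Lemma recb_leq n f g : rec n f -> rec n g -> recb n (fun s => f s <= g s).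
Proof.
move=> Rf Rg; have: rec n (fun s => 1 - (f s - g s)) by rec_tac.
by apply: rec_eq => s _; rewrite /leq; case: (f s - g s).
Qed.
#[export] Hint Resolve recb_and recb_or recb_imp recb_leq : rec.

Lemma recb_eqn n f g : rec n f -> rec n g -> recb n (fun s => f s == g s).
Proof.
move=> Rf Rg.
have: recb n (fun s => (f s <= g s) && (g s <= f s)) by rec_tac.
by apply: rec_eq => s _; rewrite eqn_leq.
Qed.
#[export] Hint Resolve recb_eqn : rec.

Lemma recb_has n g (p : seq nat -> nat -> bool) :
  rec n g -> recb n.+2 (fun s => p (drop 2 s) (nth 0 s 0)) ->
  recb n (fun s => has (p s) (iota 0 (g s))).
Proof.
move=> Rg Rp.
have: rec n (fun s => iteri (g s) (fun k r => if p s k then 1 else r) 0).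
  by apply: rec_iteri; rec_tac.
apply: rec_eq => s _; elim: (g s) => // k IHk.
rewrite -addn1 iotaD has_cat addn1 /= IHk orbF.
by case: (p s k); rewrite ?orbT ?orbF.
Qed.

Lemma recb_all n g (p : seq nat -> nat -> bool) :
  rec n g -> recb n.+2 (fun s => p (drop 2 s) (nth 0 s 0)) ->
  recb n (fun s => all (p s) (iota 0 (g s))).
Proof.
move=> Rg Rp.
have: recb n (fun s => ~~ has (fun k => ~~ p s k) (iota 0 (g s))).
  by apply: recb_not; apply: recb_has; rec_tac.
apply: rec_eq => s _; rewrite -all_predC; congr nat_of_bool.
by apply: eq_all => k /=; rewrite negbK.
Qed.
#[export] Hint Resolve recb_has recb_all : rec.

Lemma recb_odd n f : rec n f -> recb n (fun s => odd (f s)).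
Proof.
move=> Rf; have: rec n (fun s => iter (f s) (fun r => 1 - r) 0) by rec_tac.
by apply: rec_eq => s _; elim: (f s) => //= k ->; case: (odd k).
Qed.
#[export] Hint Resolve recb_odd : rec.

Lemma rec_half n f : rec n f -> rec n (fun s => (f s)./2).
Proof.
move=> Rf; have: rec n (fun s => iteri (f s) (fun k r => odd k + r) 0) by rec_tac.
by apply: rec_eq => s _; elim: (f s) => // k /= ->; rewrite uphalf_half.
Qed.
#[export] Hint Resolve rec_half : rec.

(** * Pairing, lists and course-of-values recursion *)

Lemma rec_npair n f g : rec n f -> rec n g -> rec n (fun s => npair (f s) (g s)).
Proof.
move=> Rf Rg.
(* The binomial ['C(k, 2)] is the sum of the numbers below [k], which an iteration accumulates. *)
have: rec n (fun s => iteri (f s + g s).+1 addn 0 + f s) by rec_tac.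
apply: rec_eq => s _; rewrite /npair -bin2_sum; congr addn.
elim: (f s + g s).+1 => [|k IHk]; first by rewrite big_geq.
by rewrite big_nat_recr //= IHk addnC.
Qed.
#[export] Hint Resolve rec_npair : rec.

Definition nfind N (p : nat -> bool) : nat :=
  iteri N (fun k r => if p k then k else r) 0.

Lemma nfind_eq N p m : m < N -> (forall k, p k = (k == m)) -> nfind N p = m.
Proof.
move=> lt_m pE; elim: N lt_m => //= N IHN.
rewrite ltnS leq_eqVlt /nfind /= pE eq_sym; case: eqP => //= _; exact: IHN.
Qed.

Definition pfst z :=
  nfind z.+1 (fun m => has (fun n => npair m n == z) (iota 0 z.+1)).
Definition psnd z :=
  nfind z.+1 (fun n => has (fun m => npair m n == z) (iota 0 z.+1)).

(** Source of the size bounds below: both components are at most the pair, and the second is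
    strictly smaller as soon as the first is positive. *)
Lemma npair_geq m n : m.*2 + n <= npair m n.
Proof. by rewrite /npair binS bin1; lia. Qed.

Lemma pfstK m n : pfst (npair m n) = m.
Proof.
have le := npair_geq m n.
apply: nfind_eq => [|k]; first by lia.
apply/hasP/eqP => [[j _ /eqP/npair_inj[]//]|->].
by exists n => //; rewrite mem_iota; lia.
Qed.

Lemma psndK m n : psnd (npair m n) = n.
Proof.
have le := npair_geq m n.
apply: nfind_eq => [|k]; first by lia.
apply/hasP/eqP => [[j _ /eqP/npair_inj[]//]|->].
by exists m => //; rewrite mem_iota; lia.
Qed.

Definition npairK := (pfstK, psndK).

Lemma rec_pfst n f : rec n f -> rec n (fun s => pfst (f s)).
Proof. by move=> Rf; rewrite /pfst /nfind; rec_tac. Qed.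

Lemma rec_psnd n f : rec n f -> rec n (fun s => psnd (f s)).
Proof. by move=> Rf; rewrite /psnd /nfind; rec_tac. Qed.
#[export] Hint Resolve rec_pfst rec_psnd : rec.

(** Every number reads as an infinite sequence, so certificates need no well-formedness condition;
    their length is stored apart. *)
Definition look y i := pfst (iter i psnd y).

Lemma look_foldr l i : i < size l -> look (foldr npair 0 l) i = nth 0 l i.
Proof.
rewrite /look; elim: l i => // a l IHl [|i] /=; first by rewrite pfstK.
by move=> /IHl <-; rewrite -iterS iterSr psndK.
Qed.

Lemma rec_look n f g : rec n f -> rec n g -> rec n (fun s => look (f s) (g s)).
Proof. by move=> Rf Rg; rewrite /look; rec_tac. Qed.
#[export] Hint Resolve rec_look : rec.

(** The table lists the values most recent first: at stage [k] the value at [j < k] sits at index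
    [k.-1 - j]. Requests at [j >= k] return junk, hence the hypothesis of [covE] that [step k]
    depends only on values below [k]. *)
Definition covtab (step : nat -> (nat -> nat) -> nat) n :=
  iteri n (fun k r => npair (step k (fun j => look r (k.-1 - j))) r) 0.

Definition cov step k := pfst (covtab step k.+1).

Lemma look_covtab step k j : j < k -> look (covtab step k) (k.-1 - j) = cov step j.
Proof.
elim: k => // k IHk; rewrite ltnS leq_eqVlt => /orP[/eqP->|lt_j].
  by rewrite subnn.
rewrite -IHk // /look /covtab /=.
have -> : k - j = (k.-1 - j).+1 by lia.
by rewrite iterSr psndK.
Qed.

Lemma covE step k :
  (forall g g', (forall j, j < k -> g j = g' j) -> step k g = step k g') ->
  cov step k = step k (cov step).
Proof.
move=> ext; rewrite /cov {1}/covtab /= pfstK; apply: ext => j lt_j.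
exact: look_covtab.
Qed.

(** [S] takes a function as argument, so recursiveness is required only at the table lookup, the one
    function it is ever applied to. *)
Lemma rec_cov n (S : seq nat -> nat -> (nat -> nat) -> nat) g :
  rec n g ->
  rec n.+2 (fun s => S (drop 2 s) (nth 0 s 0)
                       (fun j => look (nth 0 s 1) ((nth 0 s 0).-1 - j))) ->
  rec n (fun s => cov (S s) (g s)).
Proof.
move=> Rg RS; apply: rec_pfst; apply: rec_iteri; [rec_tac|rec_tac|].
by apply: rec_npair; rec_tac.
Qed.

(* Unification would otherwise compute binomial coefficients in unary. *)
#[global] Opaque npair pfst psnd look cov.

(** * Decidability of the fragment *)

Definition left_code k := pfst (psnd k).
Definition right_code k := psnd (psnd k).

Definition is_node tag k := k == npair tag (npair (left_code k) (right_code k)).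

Lemma is_nodeE tag l r : is_node tag (npair tag (npair l r)).
Proof. by rewrite /is_node /left_code /right_code !npairK. Qed.

Lemma is_node_neq tag tag' x : tag' != tag -> is_node tag (npair tag' x) = false.
Proof.
by move=> neq; apply/eqP => /npair_inj[e _]; rewrite e eqxx in neq.
Qed.

(** The tag has to be positive: [npair 0 (npair 0 0)] is 0, which is its own left component. *)
Lemma is_node_lt tag k :
  is_node tag.+1 k -> (left_code k < k) * (right_code k < k).
Proof.
move=> /eqP; move: (left_code k) (right_code k) => l r ->.
have := npair_geq tag.+1 (npair l r); have := npair_geq l r; split; lia.
Qed.

Lemma rec_left_code n f : rec n f -> rec n (fun s => left_code (f s)).
Proof. by move=> Rf; rewrite /left_code; rec_tac. Qed.

Lemma rec_right_code n f : rec n f -> rec n (fun s => right_code (f s)).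
Proof. by move=> Rf; rewrite /right_code; rec_tac. Qed.
#[export] Hint Resolve rec_left_code rec_right_code : rec.

Lemma recb_is_node n tag f : rec n f -> recb n (fun s => is_node tag (f s)).
Proof. by move=> Rf; rewrite /is_node; rec_tac. Qed.
#[export] Hint Resolve recb_is_node : rec.

Definition test_step k (g : nat -> nat) : nat :=
  [|| k == npair 0 (psnd k), k == npair 2 0, k == npair 3 0
    | (is_node 4 k || is_node 5 k) &&
      ((g (left_code k) != 0) && (g (right_code k) != 0))].

Definition test_check k := cov test_step k != 0.

Lemma test_checkE k :
  test_check k = [|| k == npair 0 (psnd k), k == npair 2 0, k == npair 3 0
    | (is_node 4 k || is_node 5 k) &&
      (test_check (left_code k) && test_check (right_code k))].
Proof.
rewrite /test_check covE; last first.
  move=> g g' e; rewrite /test_step.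
  case: (boolP (is_node 4 k || is_node 5 k)) => //.
  by move=> /orP[] /is_node_lt[] lt_l lt_r; rewrite !e.
by rewrite {1}/test_step; case: [|| _, _, _ | _].
Qed.

Lemma recb_test_check n f : rec n f -> recb n (fun s => test_check (f s)).
Proof.
move=> Rf; rewrite /test_check; apply: recb_not; apply: recb_eqn; last by rec_tac.
by apply: rec_cov; rewrite // /test_step; rec_tac.
Qed.
#[export] Hint Resolve recb_test_check : rec.

Lemma test_checkP k :
  test_check k <-> exists2 b, k = term_code b & is_test b.
Proof.
split=> [|[b ->]]; last first.
  elim=> {b} [[i c]|||b c _ IHb _ IHc|b c _ IHb _ IHc]; rewrite test_checkE /=.
  - by rewrite !npairK eqxx.
  - by rewrite eqxx orbT.
  - by rewrite eqxx !orbT.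
  - by rewrite is_nodeE /left_code /right_code !npairK IHb IHc !orbT.
  - by rewrite is_nodeE /left_code /right_code !npairK IHb IHc !orbT.
elim/ltn_ind: k => k IHk; rewrite test_checkE.
case/or4P => [/eqP->|/eqP->|/eqP->|].
(* Every number [d] is [i.*2 + c] for exactly one primitive test [(i, c)]. *)
- move: (psnd k) => d; exists (TVar (PTest (d./2, odd d))); last by constructor.
  by rewrite /= addnC odd_double_half.
- by exists TI; last constructor.
- by exists T0; last constructor.
case/andP=> /orP[] kE; have [lt_l lt_r] := is_node_lt kE;
  case/andP=> /(IHk _ lt_l) [b eb Tb] /(IHk _ lt_r) [c ec Tc].
- by exists (TSeq b c); [rewrite (eqP kE) eb ec | constructor].
- by exists (TPlus b c); [rewrite (eqP kE) eb ec | constructor].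
Qed.

Definition compl_step k (g : nat -> nat) : nat :=
  if k == npair 0 (psnd k) then
    npair 0 (if odd (psnd k) then (psnd k).-1 else (psnd k).+1)
  else if k == npair 2 0 then npair 3 0 else if k == npair 3 0 then npair 2 0
  else if is_node 4 k then npair 5 (npair (g (left_code k)) (g (right_code k)))
  else if is_node 5 k then npair 4 (npair (g (left_code k)) (g (right_code k)))
  else k.

Definition compl_code := cov compl_step.

Lemma compl_codeE k : compl_code k = compl_step k compl_code.
Proof.
apply: covE => g g' e; rewrite /compl_step.
case: eqP => // _; case: eqP => // _; case: eqP => // _.
case: ifP => [/is_node_lt[] lt_l lt_r|_]; first by rewrite !e.
by case: ifP => [/is_node_lt[] lt_l lt_r|_]; first by rewrite !e.
Qed.

Lemma rec_compl_code n f : rec n f -> rec n (fun s => compl_code (f s)).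
Proof.
by move=> Rf; apply: rec_cov; rewrite // /compl_step; rec_tac.
Qed.
#[export] Hint Resolve rec_compl_code : rec.

Lemma npair_eqE m n m' n' : (npair m n == npair m' n') = (m == m') && (n == n').
Proof.
by apply/eqP/andP => [/npair_inj[-> ->]|[/eqP-> /eqP->]].
Qed.

Lemma compl_code_term t : compl_code (term_code t) = term_code (test_compl t).
Proof.
elim: t => [[[i c]|a]|||t IHt u IHu|t IHt u IHu|t IHt u IHu|t IHt];
  rewrite compl_codeE /compl_step /= ?npairK ?npair_eqE ?is_nodeE ?is_node_neq
  //= ?eqxx /left_code /right_code ?npairK ?IHt ?IHu //.
by rewrite oddD odd_double oddb /=; case: c => /=; rewrite ?addn0 ?addn1.
Qed.

(** The clauses are the formation rules and may overlap: a conditional between tests is also a test.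
    Loops and conditionals are recognised by their expansions, so these clauses recurse deeper than
    the immediate subterms. *)
Definition pwp_step k (g : nat -> nat) : nat :=
  let l := left_code k in let r := right_code k in
  [|| test_check k, k == npair 1 (psnd k),
      is_node 4 k && ((g l != 0) && (g r != 0)),
      is_node 4 k && (l == npair 7 (psnd l)) && is_node 4 (psnd l) &&
        [&& test_check (left_code (psnd l)), r == compl_code (left_code (psnd l))
          & g (right_code (psnd l)) != 0],
      is_node 5 k && (is_node 4 l && is_node 4 r) &&
        [&& test_check (left_code l), left_code r == compl_code (left_code l),
            g (right_code l) != 0 & g (right_code r) != 0]
    | is_node 6 k && (r == npair 2 0) && (g l != 0)].

Definition pwp_check k := cov pwp_step k != 0.

Lemma pwp_checkE k : pwp_check k =
  let l := left_code k in let r := right_code k in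
  [|| test_check k, k == npair 1 (psnd k),
      is_node 4 k && (pwp_check l && pwp_check r),
      is_node 4 k && (l == npair 7 (psnd l)) && is_node 4 (psnd l) &&
        [&& test_check (left_code (psnd l)), r == compl_code (left_code (psnd l))
          & pwp_check (right_code (psnd l))],
      is_node 5 k && (is_node 4 l && is_node 4 r) &&
        [&& test_check (left_code l), left_code r == compl_code (left_code l),
            pwp_check (right_code l) & pwp_check (right_code r)]
    | is_node 6 k && (r == npair 2 0) && pwp_check l].
Proof.
rewrite /pwp_check covE; last first.
  move=> g g' e; rewrite /pwp_step; congr nat_of_bool.
  congr [|| _, _ , _, _, _ | _].
  - by case: (boolP (is_node 4 k)) => // /is_node_lt[] lt_l lt_r; rewrite !e.
  - case: (boolP (is_node 4 k)) => // /is_node_lt[] lt_l _.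
    case: eqP => //= el; case: (boolP (is_node 4 _)) => // /is_node_lt[] _ lt_r.
    rewrite e //; apply: ltn_trans lt_r (leq_ltn_trans _ lt_l).
    by rewrite {2}el; have := npair_geq 7 (psnd (left_code k)); lia.
  - case: (boolP (is_node 5 k)) => // /is_node_lt[] lt_l lt_r.
    case: (boolP (is_node 4 _)) => // /is_node_lt[] _ lt_lr.
    case: (boolP (is_node 4 _)) => // /is_node_lt[] _ lt_rr.
    by rewrite !e //; [apply: ltn_trans lt_rr lt_r | apply: ltn_trans lt_lr lt_l].
  - by case: (boolP (is_node 6 k)) => // /is_node_lt[] lt_l lt_r; rewrite !e.
by rewrite {1}/pwp_step /=; case: [|| _, _, _, _, _ | _].
Qed.

Lemma recb_pwp_check n f : rec n f -> recb n (fun s => pwp_check (f s)).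
Proof.
move=> Rf; rewrite /pwp_check; apply: recb_not; apply: recb_eqn; last by rec_tac.
by apply: rec_cov; rewrite // /pwp_step; rec_tac.
Qed.
#[export] Hint Resolve recb_pwp_check : rec.

Lemma pwp_checkP k :
  pwp_check k <-> exists2 t, k = term_code t & PWP_loop t.
Proof.
split=> [|[t ->]]; last first.
  elim=> {t} [b Tb|a|t u _ IHt _ IHu|b t u Tb _ IHt _ IHu|b t Tb _ IHt|t _ IHt];
    rewrite pwp_checkE /=.
  - by have /test_checkP-> : exists2 b', term_code b = term_code b' & is_test b'
      by exists b.
  - by rewrite !npairK eqxx orbT.
  - by rewrite (is_nodeE 4) /left_code /right_code !npairK IHt IHu !orbT.
  - have /test_checkP Cb : exists2 b', term_code b = term_code b' & is_test b'
      by exists b.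
    rewrite (is_nodeE 5) /left_code /right_code !npairK !(is_nodeE 4) IHt IHu Cb.
    by rewrite compl_code_term (eqxx (term_code (test_compl b))) !orbT.
  - have /test_checkP Cb : exists2 b', term_code b = term_code b' & is_test b'
      by exists b.
    rewrite (is_nodeE 4) /left_code /right_code !npairK !(is_nodeE 4) IHt Cb.
    by rewrite compl_code_term (eqxx (term_code (test_compl b))) (eqxx (npair 7 _))
      !orbT.
  - by do 5![apply/orP; right];
      rewrite (is_nodeE 6) /left_code /right_code !npairK IHt (eqxx (npair 2 0)).
elim/ltn_ind: k => k IHk; rewrite pwp_checkE /=.
case/orP => [/test_checkP[t et Tt]|]; first by exists t => //; constructor.
case/orP => [/eqP->|]; first by exists (TVar (Action (psnd k))); last constructor.
case/or4P.
- case/andP=> kE; have [lt_l lt_r] := is_node_lt kE.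
  case/andP=> /(IHk _ lt_l) [t et Tt] /(IHk _ lt_r) [u eu Tu].
  by exists (TSeq t u); [rewrite (eqP kE) et eu | constructor].
- case/andP=> /andP[/andP[kE /eqP lE] lE'].
  case/and3P=> /test_checkP[b eb Tb] /eqP rE /IHk[|t et Tt].
    have [lt_l _] := is_node_lt kE; have [_ lt_r] := is_node_lt lE'.
    have := npair_geq 7 (psnd (left_code k)); lia.
  exists (twhile b t); last by constructor.
  by rewrite (eqP kE) lE (eqP lE') rE eb et compl_code_term.
- case/andP=> /andP[kE /andP[lE rE]].
  have [lt_l lt_r] := is_node_lt kE.
  have [_ lt_lr] := is_node_lt lE; have [_ lt_rr] := is_node_lt rE.
  case/and4P=> /test_checkP[b eb Tb] /eqP ec /IHk[|t et Tt]; first by lia.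
  move=> /IHk[|u eu Tu]; first by lia.
  exists (tif b t u); last by constructor.
  by rewrite (eqP kE) (eqP lE) (eqP rE) ec eb et eu compl_code_term.
- case/andP=> /andP[kE /eqP rE] /IHk[|t et Tt].
    by have [] := is_node_lt kE.
  by exists (tloop t); [rewrite (eqP kE) rE et | constructor].
Qed.

(** * Occurrences of actions and of primitive tests *)

Definition occ_step (leaf : nat -> bool) k (g : nat -> nat) : nat :=
  [|| leaf k,
      (is_node 4 k || is_node 5 k || is_node 6 k) &&
        ((g (left_code k) != 0) || (g (right_code k) != 0))
    | (k == npair 7 (psnd k)) && (g (psnd k) != 0)].

Definition occ leaf k := cov (occ_step leaf) k != 0.

Lemma occE leaf k : occ leaf k =
  [|| leaf k,
      (is_node 4 k || is_node 5 k || is_node 6 k) &&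
        (occ leaf (left_code k) || occ leaf (right_code k))
    | (k == npair 7 (psnd k)) && occ leaf (psnd k)].
Proof.
rewrite /occ covE; last first.
  move=> g g' e; rewrite /occ_step; congr nat_of_bool.
  congr [|| _, _ | _].
    case: (boolP (is_node 4 k || is_node 5 k || is_node 6 k)) => //.
    by move=> /orP[/orP[]|] /is_node_lt[] lt_l lt_r; rewrite !e.
  case: eqP => //= ek; rewrite e //; rewrite {2}ek.
  by have := npair_geq 7 (psnd k); lia.
by rewrite {1}/occ_step; case: [|| _, _ | _].
Qed.

(** The recursion evaluates [leaf] under its own bound variables, hence the hypothesis over all
    environments. *)
Lemma recb_occ n (leaf : seq nat -> nat -> bool) f :
  rec n f ->
  (forall m (e : seq nat -> seq nat) g, recenv m n e -> rec m g ->
     recb m (fun s => leaf (e s) (g s))) ->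
  recb n (fun s => occ (leaf s) (f s)).
Proof.
move=> Rf Rl; rewrite /occ; apply: recb_not; apply: recb_eqn; last by rec_tac.
apply: rec_cov => //; rewrite /occ_step.
have R : recb n.+2 (fun s => leaf (drop 2 s) (nth 0 s 0)).
  by apply: Rl; [rec_env | rec_tac].
by apply: rec_of_recb; apply: recb_or; [exact: R | rec_tac].
Qed.

Definition is_var_code k := (k == npair 0 (psnd k)) || (k == npair 1 (psnd k)).

Lemma occ_term (leaf : nat -> bool) t :
  (forall k, leaf k -> is_var_code k) ->
  occ leaf (term_code t) = has (fun x => leaf (term_code (TVar x))) (vars t).
Proof.
move=> leafP.
have leaf0 tag x : 1 < tag -> leaf (npair tag x) = false.
  move=> gt1; apply/negP => /leafP; rewrite /is_var_code !npair_eqE.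
  by case: tag gt1 => [|[]].
elim: t => [x|||t IHt u IHu|t IHt u IHu|t IHt u IHu|t IHt]; rewrite occE /=.
- rewrite orbF; case: x => [[i c]|a] /=; rewrite !is_node_neq //= npair_eqE /=;
  by rewrite orbF.
- by rewrite leaf0 // !is_node_neq // npair_eqE.
- by rewrite leaf0 // !is_node_neq // npair_eqE.
- rewrite leaf0 // (is_nodeE 4) /left_code /right_code !npairK IHt IHu npair_eqE.
  by rewrite has_cat /= orbF.
- rewrite leaf0 // (is_nodeE 5) (is_node_neq (tag := 4)) //.
  rewrite /left_code /right_code !npairK IHt IHu npair_eqE.
  by rewrite has_cat /= orbF.
- rewrite leaf0 // (is_nodeE 6) (is_node_neq (tag := 4)) // (is_node_neq (tag := 5)) //.
  rewrite /left_code /right_code !npairK IHt IHu npair_eqE.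
  by rewrite has_cat /= orbF.
- rewrite leaf0 // !is_node_neq // !npairK IHt npair_eqE.
  by rewrite !eqxx.
Qed.

Definition action_leaf a k := k == npair 1 a.
(** Halving forgets the sign, so [p] and its complement count once. *)
Definition ptest_leaf i k := (k == npair 0 (psnd k)) && ((psnd k)./2 == i).

Definition actions t :=
  pmap (fun x => if x is Action a then Some a else None) (vars t).
Definition ptests t :=
  pmap (fun x => if x is PTest p then Some p.1 else None) (vars t).

Lemma mem_pmap_has (A : Type) (B : eqType) (f : A -> option B) b s :
  (b \in pmap f s) = has (fun x => f x == Some b) s.
Proof.
elim: s => //= x s IHs; case fx: (f x) => [c|] /=; rewrite ?IHs //.
by rewrite in_cons IHs eq_sym.
Qed.

Lemma occ_action a t : occ (action_leaf a) (term_code t) = (a \in actions t).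
Proof.
rewrite occ_term => [|k /eqP->]; last by rewrite /is_var_code npairK eqxx orbT.
rewrite mem_pmap_has; apply: eq_has => -[p|b]; rewrite /action_leaf /= npair_eqE //=.
Qed.

Lemma occ_ptest i t : occ (ptest_leaf i) (term_code t) = (i \in ptests t).
Proof.
rewrite occ_term => [|k /andP[kE _]]; last by rewrite /is_var_code kE.
rewrite mem_pmap_has; apply: eq_has => -[[j c]|b]; rewrite /ptest_leaf /= npair_eqE //=.
by rewrite npairK eqxx /= addnC half_bit_double.
Qed.

Lemma recb_occ_action n f g :
  rec n f -> rec n g -> recb n (fun s => occ (action_leaf (f s)) (g s)).
Proof.
move=> Rf Rg; apply: recb_occ => // m e h Re Rh; rewrite /action_leaf.
by have Rfe := Re _ Rf; rec_tac.
Qed.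

Lemma recb_occ_ptest n f g :
  rec n f -> rec n g -> recb n (fun s => occ (ptest_leaf (f s)) (g s)).
Proof.
move=> Rf Rg; apply: recb_occ => // m e h Re Rh; rewrite /ptest_leaf.
by have Rfe := Re _ Rf; rec_tac.
Qed.
#[export] Hint Resolve recb_occ_action recb_occ_ptest : rec.

(** Indices of variables are bounded by the code of the term, which makes the quantifiers of
    [fragment_check] bounded. *)
Lemma var_code_le t : all (fun x => term_code (TVar x) <= term_code t) (vars t).
Proof.
have sub (u w : term) : term_code u <= term_code w ->
    all (fun x => term_code (TVar x) <= term_code u) (vars u) ->
    all (fun x => term_code (TVar x) <= term_code w) (vars u).
  by move=> le_uw; apply: sub_all => x /leq_trans; apply.
elim: t => [x|||t IHt u IHu|t IHt u IHu|t IHt u IHu|t IHt] //=.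
- by rewrite leqnn.
- rewrite all_cat (sub t (TSeq t u)) ?(sub u (TSeq t u)) //=;
  by have := npair_geq 4 (npair (term_code t) (term_code u));
  have := npair_geq (term_code t) (term_code u); lia.
- rewrite all_cat (sub t (TPlus t u)) ?(sub u (TPlus t u)) //=;
  by have := npair_geq 5 (npair (term_code t) (term_code u));
  have := npair_geq (term_code t) (term_code u); lia.
- rewrite all_cat (sub t (TCap t u)) ?(sub u (TCap t u)) //=;
  by have := npair_geq 6 (npair (term_code t) (term_code u));
  have := npair_geq (term_code t) (term_code u); lia.
- by apply: (sub t (TStar t)) => //=; have := npair_geq 7 (term_code t); lia.
Qed.

Lemma mem_pmap_le (f : var -> option nat) t b :
  (forall x c, f x = Some c -> c <= term_code (TVar x)) ->
  b \in pmap f (vars t) -> b <= term_code t.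
Proof.
move=> fP; rewrite mem_pmap_has; have := var_code_le t.
elim: (vars t) => //= x s IHs /andP[le_x /IHs {}IHs] /orP[/eqP/fP le_b|//].
exact: leq_trans le_b le_x.
Qed.

Lemma action_le t a : a \in actions t -> a <= term_code t.
Proof.
by apply: mem_pmap_le => -[//|c] b [->] /=; have := npair_geq 1 b; lia.
Qed.

Lemma ptest_le t i : i \in ptests t -> i <= term_code t.
Proof.
apply: mem_pmap_le => -[[j c]|//] b [->] /=; have := npair_geq 0 (b.*2 + c); lia.
Qed.

(** Cardinality as covering, which bounded search can express. The last condition keeps the covering
    values, the padding [x0] included, within the range of that search. *)
Lemma size_undup_le (T : eqType) (x0 : T) (s : seq T) m :
  (size (undup s) <= m) <->
  exists2 r, size r = m & {subset s <= r} /\ {subset r <= x0 :: s}.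
Proof.
split=> [le_s|[r <- [sub _]]]; last first.
  by apply: uniq_leq_size; rewrite ?undup_uniq // => x; rewrite mem_undup => /sub.
exists (undup s ++ nseq (m - size (undup s)) x0).
  by rewrite size_cat size_nseq subnKC.
split=> x; rewrite mem_cat mem_undup ?inE; first by move->.
by case/orP=> [->|/nseqP[-> _]]; rewrite ?eqxx ?orbT.
Qed.

Definition fragment_check x :=
  [&& pwp_check x,
      has (fun a1 => has (fun a2 => has (fun a3 => has (fun a4 =>
        all (fun a => occ (action_leaf a) x ==>
               [|| a == a1, a == a2, a == a3 | a == a4]) (iota 0 x.+1))
        (iota 0 x.+1)) (iota 0 x.+1)) (iota 0 x.+1)) (iota 0 x.+1)
    & has (fun i => occ (ptest_leaf i) x &&
        all (fun j => occ (ptest_leaf j) x ==> (j == i)) (iota 0 x.+1))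
        (iota 0 x.+1)].

Lemma recb_fragment_check n f : rec n f -> recb n (fun s => fragment_check (f s)).
Proof. by move=> Rf; rewrite /fragment_check; rec_tac. Qed.
#[export] Hint Resolve recb_fragment_check : rec.

Definition fragment t : Prop :=
  [/\ PWP_loop t, num_actions t <= 4 & num_ptests t = 1].

Lemma fragment_checkP x :
  fragment_check x <-> exists2 t, x = term_code t & fragment t.
Proof.
have inI t k : (k \in iota 0 (term_code t).+1) = (k <= term_code t).
  by rewrite mem_iota.
split=> [/and3P[/pwp_checkP[t -> Pt] act /hasP[i _ /andP[pi /allP pj]]]|].
  exists t => //; split=> //.
    case/hasP: act => a1 _ /hasP[a2 _ /hasP[a3 _ /hasP[a4 _ /allP act]]].
    apply: (@leq_trans (size [:: a1; a2; a3; a4])) => //.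
    apply: uniq_leq_size; first exact: undup_uniq.
    move=> a; rewrite mem_undup => aP; rewrite !inE.
    by apply: (implyP (act a _)); rewrite ?inI ?occ_action ?action_le.
  apply/eqP; rewrite eqn_leq; apply/andP; split; last first.
    rewrite occ_ptest -mem_undup in pi.
    by rewrite /num_ptests -/(ptests t) lt0n size_eq0; case: (undup _) pi.
  apply: (@leq_trans (size [:: i])) => //.
  apply: uniq_leq_size; first exact: undup_uniq.
  move=> j; rewrite mem_undup => jP; rewrite inE.
  by apply: (implyP (pj j _)); rewrite ?inI ?occ_ptest ?ptest_le.
case=> t -> [Pt act pt]; apply/and3P; split.
- by apply/pwp_checkP; exists t.
- have /(size_undup_le 0)[r sz [sub sup]] := act.
  have bd k : k < 4 -> nth 0 r k \in iota 0 (term_code t).+1.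
    rewrite -sz => /(mem_nth 0) /sup; rewrite inI inE => /orP[/eqP->//|].
    exact: action_le.
  apply/hasP; exists (nth 0 r 0); first exact: bd.
  apply/hasP; exists (nth 0 r 1); first exact: bd.
  apply/hasP; exists (nth 0 r 2); first exact: bd.
  apply/hasP; exists (nth 0 r 3); first exact: bd.
  apply/allP => a _; apply/implyP; rewrite occ_action => /sub.
  by case: r sz {sub sup bd} => [|a1 [|a2 [|a3 [|a4 []]]]] //= _; rewrite !inE.
have : size (undup (ptests t)) = 1 by exact: pt.
case E: (undup _) => [|i []] // _.
have mE j : (j \in ptests t) = (j == i) by rewrite -mem_undup E inE.
apply/hasP; exists i; first by rewrite inI; apply: ptest_le; rewrite mE.
rewrite occ_ptest mE eqxx andTb; apply/allP => j _.
by rewrite occ_ptest mE implybb.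
Qed.

(** * Certificates of nonemptiness *)

(* A fact (term_code t, (a, b)) asserts that t relates a to b. *)
Definition fact (B : Type) := (nat * (B * B))%type.

Inductive derives (B : eqType) (v : valuation B) (L : seq (fact B)) :
  term -> B -> B -> Prop :=
| derives_var x a b : v x a b -> derives v L (TVar x) a b
| derives_I a : derives v L TI a a
| derives_seq t u a b c : (term_code t, (a, c)) \in L ->
    (term_code u, (c, b)) \in L -> derives v L (TSeq t u) a b
| derives_plusl t u a b : (term_code t, (a, b)) \in L ->
    derives v L (TPlus t u) a b
| derives_plusr t u a b : (term_code u, (a, b)) \in L ->
    derives v L (TPlus t u) a b
| derives_cap t u a b : (term_code t, (a, b)) \in L ->
    (term_code u, (a, b)) \in L -> derives v L (TCap t u) a b
| derives_star0 t a : derives v L (TStar t) a a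
| derives_star1 t a b c : (term_code t, (a, c)) \in L ->
    (term_code (TStar t), (c, b)) \in L -> derives v L (TStar t) a b.

Inductive derivation (B : eqType) (v : valuation B) : seq (fact B) -> Prop :=
| derivation_nil : derivation v [::]
| derivation_rcons L t a b : derivation v L -> derives v L t a b ->
    derivation v (rcons L (term_code t, (a, b))).

Lemma derives_sub (B : eqType) (v : valuation B) L L' t a b :
  {subset L <= L'} -> derives v L t a b -> derives v L' t a b.
Proof.
move=> sub; case=> {t a b}.
- by move=> *; apply: derives_var.
- exact: derives_I.
- by move=> t u a b c /sub Lt /sub Lu; apply: derives_seq Lt Lu.
- by move=> t u a b /sub Lt; apply: derives_plusl.
- by move=> t u a b /sub Lt; apply: derives_plusr.
- by move=> t u a b /sub Lt /sub Lu; apply: derives_cap.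
- exact: derives_star0.
- by move=> t a b c /sub Lt /sub Lu; apply: derives_star1 Lt Lu.
Qed.

Lemma derivation_cat (B : eqType) (v : valuation B) L L' :
  derivation v L -> derivation v L' -> derivation v (L ++ L').
Proof.
move=> dL; elim=> [|L2 t a b dL2 IH2 der]; first by rewrite cats0.
rewrite -rcons_cat; apply: derivation_rcons => //.
by apply: derives_sub der => x Lx; rewrite mem_cat Lx orbT.
Qed.

Definition derivable (B : eqType) (v : valuation B) t a b :=
  exists2 L, derivation v L & (term_code t, (a, b)) \in L.

Lemma derivable1 (B : eqType) (v : valuation B) L t a b :
  derivation v L -> derives v L t a b -> derivable v t a b.
Proof.
move=> dL der; exists (rcons L (term_code t, (a, b))).
  exact: derivation_rcons.
by rewrite mem_rcons mem_head.
Qed.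

Lemma derivable2 (B : eqType) (v : valuation B) t u w a b a1 b1 a2 b2 :
  derivable v t a1 b1 -> derivable v u a2 b2 ->
  (forall L, (term_code t, (a1, b1)) \in L -> (term_code u, (a2, b2)) \in L ->
     derives v L w a b) -> derivable v w a b.
Proof.
move=> [L dL Lt] [L' dL' Lu] der.
apply: (derivable1 (derivation_cat dL dL')).
by apply: der; rewrite mem_cat ?Lt ?Lu ?orbT.
Qed.

Lemma eval_derivable (B : eqType) (v : valuation B) t a b :
  eval v t a b -> derivable v t a b.
Proof.
have nil := derivation_nil v.
elim: t a b => [x|||t IHt u IHu|t IHt u IHu|t IHt u IHu|t IHt] a b /=.
- by move=> vx; apply: (derivable1 nil); apply: derives_var.
- by move=> <-; apply: (derivable1 nil); apply: derives_I.
- by [].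
- move=> [c /IHt dt /IHu du]; apply: (derivable2 dt du) => L Lt Lu.
  exact: derives_seq Lt Lu.
- case=> [/IHt|/IHu] [L dL Ld]; apply: (derivable1 dL).
    exact: derives_plusl.
  exact: derives_plusr.
- move=> [/IHt dt /IHu du]; apply: (derivable2 dt du) => L Lt Lu.
  exact: derives_cap.
- move/clos_rt_rt1n_iff; elim=> {a b} [a|a c b /IHt dt _ du].
    by apply: (derivable1 nil); apply: derives_star0.
  by apply: (derivable2 dt du) => L Lt Lu; apply: derives_star1 Lt Lu.
Qed.

Lemma derivation_var (B : eqType) (v : valuation B) L x a b :
  derivation v L -> (term_code (TVar x), (a, b)) \in L -> v x a b.
Proof.
elim=> // {}L t a' b' _ IHL der; rewrite mem_rcons in_cons => /orP[/eqP[]|//].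
move=> /(@term_code_inj (TVar x)) et -> ->.
by rewrite -et in der; inversion der.
Qed.

Lemma derivation_term (B : eqType) (v : valuation B) L k a b :
  derivation v L -> (k, (a, b)) \in L -> exists t, k = term_code t.
Proof.
elim=> // {}L t a' b' _ IHL _; rewrite mem_rcons in_cons => /orP[/eqP[->]|//].
by exists t.
Qed.

Definition fact_term y i := pfst (look y i).
Definition fact_src y i := pfst (psnd (look y i)).
Definition fact_tgt y i := psnd (psnd (look y i)).
Definition is_fact y i k a b := look y i == npair k (npair a b).

Lemma recb_is_fact n f g h p q :
  rec n f -> rec n g -> rec n h -> rec n p -> rec n q ->
  recb n (fun s => is_fact (f s) (g s) (h s) (p s) (q s)).
Proof. by move=> Rf Rg Rh Rp Rq; rewrite /is_fact; rec_tac. Qed.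

Lemma rec_fact_term n f g :
  rec n f -> rec n g -> rec n (fun s => fact_term (f s) (g s)).
Proof. by move=> Rf Rg; rewrite /fact_term; rec_tac. Qed.

Lemma rec_fact_src n f g :
  rec n f -> rec n g -> rec n (fun s => fact_src (f s) (g s)).
Proof. by move=> Rf Rg; rewrite /fact_src; rec_tac. Qed.

Lemma rec_fact_tgt n f g :
  rec n f -> rec n g -> rec n (fun s => fact_tgt (f s) (g s)).
Proof. by move=> Rf Rg; rewrite /fact_tgt; rec_tac. Qed.
#[export] Hint Resolve recb_is_fact rec_fact_term rec_fact_src rec_fact_tgt : rec.

Definition has_fact y i k a b := has (fun j => is_fact y j k a b) (iota 0 i).

Lemma has_factP y i k a b :
  reflect (exists2 j, j < i & look y j = npair k (npair a b))
          (has_fact y i k a b).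
Proof.
apply: (iffP hasP) => -[j]; first by rewrite mem_iota => lt_j /eqP; exists j.
by move=> lt_j e; exists j; rewrite ?mem_iota //; apply/eqP.
Qed.

(** The middle point is read off the target of a listed fact, so the search runs over positions in
    the list and not over points. *)
Definition has_path y i k k' a b :=
  has (fun j => is_fact y j k a (fact_tgt y j) && has_fact y i k' (fact_tgt y j) b)
      (iota 0 i).

Lemma has_pathP y i k k' a b :
  reflect (exists2 c, has_fact y i k a c & has_fact y i k' c b)
          (has_path y i k k' a b).
Proof.
apply: (iffP hasP) => [[j lt_j /andP[fj fb]]|[c /hasP[j lt_j fj] fb]].
  by exists (fact_tgt y j) => //; apply/hasP; exists j.
exists j => //; suff -> : fact_tgt y j = c by rewrite fj.
by rewrite /fact_tgt (eqP fj) !npairK.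
Qed.

Lemma recb_has_fact n f g h p q :
  rec n f -> rec n g -> rec n h -> rec n p -> rec n q ->
  recb n (fun s => has_fact (f s) (g s) (h s) (p s) (q s)).
Proof. by move=> Rf Rg Rh Rp Rq; rewrite /has_fact; rec_tac. Qed.
#[export] Hint Resolve recb_has_fact : rec.

Lemma recb_has_path n f g h k p q :
  rec n f -> rec n g -> rec n h -> rec n k -> rec n p -> rec n q ->
  recb n (fun s => has_path (f s) (g s) (h s) (k s) (p s) (q s)).
Proof. by move=> Rf Rg Rh Rk Rp Rq; rewrite /has_path; rec_tac. Qed.
#[export] Hint Resolve recb_has_path : rec.

(** Atoms are accepted as assumptions, tests on the diagonal only; whether they are compatible with
    each other is left to [coherent]. No clause has tag 3, as [0] relates nothing. *)
Definition step_check y i k a b : bool :=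
  let tag := pfst k in let l := left_code k in let r := right_code k in
  [|| (tag == 0) && (a == b), tag == 1, (tag == 2) && (a == b),
      (tag == 4) && has_path y i l r a b,
      (tag == 5) && (has_fact y i l a b || has_fact y i r a b),
      (tag == 6) && (has_fact y i l a b && has_fact y i r a b)
    | (tag == 7) && ((a == b) || has_path y i (psnd k) k a b)].

Definition fact_check y i :=
  step_check y i (fact_term y i) (fact_src y i) (fact_tgt y i).

(** An even payload [d] stands for a negative test and [d.+1] for its positive partner; the second
    clause keeps the two from sharing a point. *)
Definition coherent y i j :=
  ((pfst (fact_term y i) == 1) && (fact_term y i == fact_term y j) &&
     (fact_src y i == fact_src y j) ==> (fact_tgt y i == fact_tgt y j)) &&
  ((pfst (fact_term y i) == 0) && ~~ odd (psnd (fact_term y i)) &&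
     (fact_term y j == npair 0 (psnd (fact_term y i)).+1) ==>
     (fact_src y i != fact_src y j)).

Definition certificate x z :=
  let n := pfst z in let y := psnd z in
  [&& all (fact_check y) (iota 0 n),
      all (fun i => all (coherent y i) (iota 0 n)) (iota 0 n)
    & has (fun i => is_fact y i x (fact_src y i) (fact_tgt y i)) (iota 0 n)].

Lemma recb_fact_check n f g :
  rec n f -> rec n g -> recb n (fun s => fact_check (f s) (g s)).
Proof. by move=> Rf Rg; rewrite /fact_check /step_check; rec_tac. Qed.

Lemma recb_coherent n f g h :
  rec n f -> rec n g -> rec n h -> recb n (fun s => coherent (f s) (g s) (h s)).
Proof. by move=> Rf Rg Rh; rewrite /coherent; rec_tac. Qed.
#[export] Hint Resolve recb_fact_check recb_coherent : rec.

Lemma recb_certificate n f g :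
  rec n f -> rec n g -> recb n (fun s => certificate (f s) (g s)).
Proof.
by move=> Rf Rg; rewrite /certificate; rec_tac.
Qed.

(** * The model read off a certificate *)

Section Soundness.
Variables (x z : nat).
Hypothesis cert : certificate x z.
Let n := pfst z.
Let y := psnd z.

Definition cert_bound := \max_(i < n) maxn (fact_src y i) (fact_tgt y i).

(** A positive test holds exactly where a fact claims it, and its complement at all other points,
    mentioned or not. Coherence makes the recorded negative facts true. *)
Definition cert_val : valuation 'I_cert_bound.+1 := fun x a b =>
  match x with
  | Action k => exists2 i, i < n & look y i = npair (npair 1 k) (npair a b)
  | PTest (i, c) => a = b /\
      c = has (fun j => (fact_term y j == npair 0 (i.*2.+1)) && (fact_src y j == a))
            (iota 0 n)
  end.

Lemma cert_coherent i j : i < n -> j < n -> coherent y i j.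
Proof.
move=> lt_i lt_j; have /and3P[_ /allP coh _] := cert.
by apply: (allP (coh i _)); rewrite mem_iota.
Qed.

Lemma cert_val_DREL : DREL_test cert_val.
Proof.
split.
- by split; exact: ord0.
- move=> [[i c]|k] a b b' /=; first by move=> [<- _] [<- _].
  move=> [i lt_i ei] [j lt_j ej]; apply: val_inj.
  have /andP[/implyP coh _] := cert_coherent lt_i lt_j; apply/eqP; move: coh.
  by rewrite /fact_term /fact_src /fact_tgt ei ej !npairK !eqxx => /(_ isT).
- by move=> [i c] a b [].
- move=> [i c] a b /=; set h := has _ _; split.
    by move=> [-> e]; split=> // -[_]; rewrite -e; case: (c).
  by move=> [-> ne]; split=> //; case: c h ne => -[] // [].
Qed.

Lemma cert_bound_lt i : i < n ->
  (fact_src y i < cert_bound.+1) * (fact_tgt y i < cert_bound.+1).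
Proof.
move=> lt_i; have := leq_bigmax (Ordinal lt_i)
  (F := fun i : 'I_n => maxn (fact_src y i) (fact_tgt y i)).
by rewrite geq_max => /andP[? ?]; split.
Qed.

(** The induction is on the position of the fact and not on the term, since a star fact may rest on
    an earlier fact about the same star. *)
Lemma cert_sound i t (a b : 'I_cert_bound.+1) : i < n ->
  look y i = npair (term_code t) (npair a b) -> eval cert_val t a b.
Proof.
elim/ltn_ind: i t a b => i IHi t a b lt_i ei.
have : fact_check y i.
  by have /and3P[/allP chk _ _] := cert; apply: chk; rewrite mem_iota.
rewrite /fact_check /fact_term /fact_src /fact_tgt ei !npairK.
have path k k' c d : has_path y i k k' c d ->
    exists2 e : 'I_cert_bound.+1, has_fact y i k c e & has_fact y i k' e d.
  case/has_pathP => e f1 f2; have [j lt_j ej] := has_factP _ _ _ _ _ f1.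
  have [_ lt_e] := cert_bound_lt (ltn_trans lt_j lt_i).
  rewrite /fact_tgt ej !npairK in lt_e.
  by exists (Ordinal lt_e).
have IHf u (c d : 'I_cert_bound.+1) :
    has_fact y i (term_code u) c d -> eval cert_val u c d.
  by case/has_factP => j lt_j; apply: IHi => //; apply: ltn_trans lt_i.
rewrite /step_check.
case: t ei => [[[j c]|k]|||t u|t u|t u|t] ei;
  rewrite /= /left_code /right_code !npairK /= ?orbF.
- move=> /eqP/val_inj eab; split=> //; symmetry; case: c ei => ei.
    apply/hasP; exists i; first by rewrite mem_iota.
    by rewrite /fact_term /fact_src ei !npairK /= addn1 !eqxx.
  apply/hasP => -[k]; rewrite mem_iota => lt_k /andP[/eqP ek /eqP sk].
  have /andP[_ /implyP] := cert_coherent lt_i lt_k.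
  rewrite ek sk /fact_term /fact_src ei !npairK /= addn0 odd_double !eqxx.
  by move/(_ isT).
- by exists i.
- by move=> /eqP/val_inj.
- by [].
- by case/path => c /IHf et /IHf eu; exists c.
- by case/orP => /IHf; [left | right].
- by case/andP => /IHf et /IHf eu.
- case/orP=> [/eqP/val_inj->|]; first exact: rt_refl.
  case/path => c /IHf et; rewrite -[npair 7 _]/(term_code (TStar t)) => /IHf eu.
  by apply: rt_trans eu; apply: rt_step.
Qed.

Lemma cert_nonempty t : x = term_code t ->
  exists a b, eval cert_val t a b.
Proof.
move=> xE; have /and3P[_ _ /hasP[i]] := cert; rewrite mem_iota => lt_i /eqP ex.
have [lt_a lt_b] := cert_bound_lt lt_i.
exists (Ordinal lt_a), (Ordinal lt_b); apply: (cert_sound lt_i).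
by rewrite ex xE.
Qed.
End Soundness.

(** * From a model to a certificate *)

Definition fact_code (B : Type) (f : B -> nat) (e : fact B) : nat :=
  npair e.1 (npair (f e.2.1) (f e.2.2)).

Lemma mem_has_fact (B : eqType) (f : B -> nat) (L : seq (fact B)) y k a b :
  (forall i, i < size L -> look y i = nth 0 (map (fact_code f) L) i) ->
  (k, (a, b)) \in L -> has_fact y (size L) k (f a) (f b).
Proof.
move=> yE /(map_f (fact_code f)) /(nthP 0)[j]; rewrite size_map => lt_j ej.
by apply/has_factP; exists j => //; rewrite yE.
Qed.

Lemma derivation_fact_check (B : eqType) (v : valuation B) (f : B -> nat) L y :
  (forall p a b, v (PTest p) a b -> a = b) -> derivation v L ->
  (forall i, i < size L -> look y i = nth 0 (map (fact_code f) L) i) ->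
  forall i, i < size L -> fact_check y i.
Proof.
move=> vP; elim=> // {}L t a b _ IHL der yE.
have yE' i : i < size L -> look y i = nth 0 (map (fact_code f) L) i.
  move=> lt_i; rewrite yE; last by rewrite size_rcons; apply: leqW.
  by rewrite map_rcons nth_rcons size_map lt_i.
move=> i; rewrite size_rcons ltnS leq_eqVlt => /orP[/eqP->|]; last exact: IHL.
have inL := mem_has_fact yE'.
have ey : look y (size L) = npair (term_code t) (npair (f a) (f b)).
  by rewrite yE ?size_rcons // map_rcons nth_rcons size_map ltnn eqxx.
rewrite /fact_check /fact_term /fact_src /fact_tgt ey !npairK /step_check.
case: der {ey yE} => {t a b} /=.
- move=> [p|k] a b; last by rewrite /= npairK.
  by move=> /vP->; rewrite /= npairK /= eqxx.
- by move=> a; rewrite npairK /= eqxx.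
- move=> t u a b c /inL ft /inL fu; rewrite /left_code /right_code !npairK /= orbF.
  by apply/has_pathP; exists (f c).
- by move=> t u a b /inL ft; rewrite /left_code /right_code !npairK /= ft.
- by move=> t u a b /inL ft; rewrite /left_code /right_code !npairK /= ft orbT.
- by move=> t u a b /inL ft /inL fu; rewrite /left_code /right_code !npairK /= ft fu.
- by move=> t a; rewrite !npairK /= eqxx.
- move=> t a b c /inL ft /inL fu; rewrite /left_code /right_code !npairK /=.
  by apply/orP; right; apply/has_pathP; exists (f c).
Qed.

Lemma nonempty_certificate (B : eqType) (v : valuation B) t a b :
  DREL_test v -> eval v t a b -> exists z, certificate (term_code t) z.
Proof.
move=> [_ vfun vid vcompl] /eval_derivable [L dL Lt].
(* Points are numbered by their first occurrence in the derivation. This is injective on the points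
   that occur, which is all that coherence asks. *)
pose els := flatten [seq [:: e.2.1; e.2.2] | e <- L].
pose f x := index x els.
have mem_els k c d : (k, (c, d)) \in L -> (c \in els) * (d \in els).
  by move=> Lc; split; apply/flatten_mapP; exists (k, (c, d));
    rewrite ?inE //= eqxx ?orbT.
have f_inj c d : c \in els -> d \in els -> f c = f d -> c = d.
  by move=> cE dE e; rewrite -(nth_index c cE) -/(f c) e nth_index.
pose y := foldr npair 0 (map (fact_code f) L).
have yE i : i < size L -> look y i = nth 0 (map (fact_code f) L) i.
  by move=> lt_i; apply: look_foldr; rewrite size_map.
have yL i : i < size L -> exists2 e, e \in L & look y i = fact_code f e.
  move=> lt_i; exists (nth (term_code t, (a, b)) L i); first exact: mem_nth.
  by rewrite yE // (nth_map (term_code t, (a, b))).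
exists (npair (size L) y); rewrite /certificate !npairK; apply/and3P; split.
- apply/allP => i; rewrite mem_iota; exact: (derivation_fact_check vid dL yE).
- apply/allP => i; rewrite mem_iota => /yL[[k [c d]] Li ei].
  apply/allP => j; rewrite mem_iota => /yL[[k' [c' d']] Lj ej].
  rewrite /coherent /fact_term /fact_src /fact_tgt ei ej /fact_code !npairK /=.
  have [u eu] := derivation_term dL Li; rewrite eu in Li *.
  have [u' eu'] := derivation_term dL Lj; rewrite eu' in Lj *.
  have [/mem_els[cE dE] /mem_els[cE' dE']] := (Li, Lj).
  apply/andP; split; apply/implyP => /andP[/andP[tag e1] e2].
    move: e2 => /eqP /f_inj ec; rewrite -(ec cE cE') in Lj.
    move: e1 => /eqP /term_code_inj e1; rewrite -e1 in Lj.
    apply/eqP; congr (f _).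
    case: u {eu e1} Li Lj tag => [x|||? ?|? ?|? ?|?] Li Lj; rewrite /= ?npairK // => _.
    exact: vfun (derivation_var dL Li) (derivation_var dL Lj).
  case: u {eu} Li tag e1 e2 => [[p|k0]|||? ?|? ?|? ?|?] Li; rewrite /= ?npairK // => _.
  case: p Li => i0 [] Li /=; first by rewrite addn1 /= odd_double.
  rewrite addn0 => _ e2.
  have e2' : term_code u' = term_code (TVar (PTest (i0, true))).
    by rewrite (eqP e2) /= addn1.
  move: e2' => /term_code_inj e2'; rewrite e2' in Lj.
  apply/eqP => /f_inj ec; rewrite -(ec cE cE') in Lj.
  have vi := derivation_var dL Li; have vj := derivation_var dL Lj.
  have ed : c = d by apply: vid vi.
  have ed' : c = d' by apply: vid vj.
  rewrite -ed in vi; rewrite -ed' in vj.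
  by have [_] := (vcompl (i0, true) c c).1 vi.
- have /(mem_has_fact yE)/has_factP[i lt_i ei] := Lt.
  apply/hasP; exists i; first by rewrite mem_iota.
  by rewrite /is_fact /fact_src /fact_tgt ei !npairK.
Qed.

Lemma nonempty_certificateP t :
  (exists z, certificate (term_code t) z) <->
  exists (B : Type) (v : valuation B) a b, DREL_test v /\ eval v t a b.
Proof.
split=> [[z cert]|[B [v [a [b [vP et]]]]]].
  have [a [b et]] := cert_nonempty cert erefl.
  exists 'I_(cert_bound z).+1, (cert_val (z := z)), a, b.
  by split=> //; apply: cert_val_DREL cert.
(* An arbitrary carrier receives decidable equality classically. *)
exact: (@nonempty_certificate (boolp.classicType B : eqType) v t a b vP et).
Qed.

Lemma term_empty_DREL_fin t :
  term_empty DREL_fin_test t <-> term_empty DREL_test t.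
Proof.
split=> [emp B v vP a b et|emp B v [vP _]]; last exact: emp.
have [z cert] : exists z, certificate (term_code t) z.
  by apply/nonempty_certificateP; exists B, v, a, b.
have [c [d]] := cert_nonempty cert erefl; apply: emp.
split; first exact: (cert_val_DREL cert).
exists (cert_bound z).+1, id; exact: (Bijective (g := id)).
Qed.

(** * Membership in $\Pi^0_1$ *)

Definition fragment_emptiness_check x z :=
  fragment_check x && ~~ certificate x z.

Lemma fragment_emptinessP x :
  emptiness_problem DREL_test fragment x <->
  forall z, fragment_emptiness_check x z.
Proof.
split=> [[t [-> Tt emp]] z|chk].
  apply/andP; split; first by apply/fragment_checkP; exists t.
  apply/negP => cert.
  have [B [v [a [b [vP et]]]]] := (nonempty_certificateP t).1 (ex_intro _ z cert).
  exact: emp vP _ _ et.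
have /andP[/fragment_checkP[t xE Tt] _] := chk 0.
exists t; split=> // B v vP a b et.
have [z cert] : exists z, certificate (term_code t) z.
  by apply/nonempty_certificateP; exists B, v, a, b.
by have := chk z; rewrite /fragment_emptiness_check xE cert andbF.
Qed.

Lemma Pi01_fragment_emptiness : Pi01 (emptiness_problem DREL_test fragment).
Proof.
exists (fun w : 2.-tuple nat =>
  nat_of_bool (~~ fragment_emptiness_check (nth 0 w 0) (nth 0 w 1))).
  have : recb 2 (fun s => ~~ fragment_emptiness_check (nth 0 s 0) (nth 0 s 1)).
    rewrite /fragment_emptiness_check.
    have R0 : rec 2 (fun s => nth 0 s 0) by exact: rec_var.
    have R1 : rec 2 (fun s => nth 0 s 1) by exact: rec_var.
    have Rc := recb_certificate R0 R1.
    by apply: recb_not; apply: recb_and; [rec_tac | exact: recb_not].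
  by [].
move=> x; rewrite fragment_emptinessP.
by split=> chk z; have := chk z; rewrite /=; case: fragment_emptiness_check.
Qed.

(** * Counter programs *)

(* [CLoop i P] is: while register i is positive, decrement it and run P. *)
Inductive cprog := CSkip | CInc of nat | CSeq of cprog & cprog
  | CLoop of nat & cprog.

Definition cstate := nat -> nat.

Definition upd (s : cstate) i k : cstate := fun j => if j == i then k else s j.

Inductive cexec : cprog -> cstate -> cstate -> Prop :=
| cexec_skip s : cexec CSkip s s
| cexec_inc i s : cexec (CInc i) s (upd s i (s i).+1)
| cexec_seq P1 P2 s1 s2 s3 :
    cexec P1 s1 s2 -> cexec P2 s2 s3 -> cexec (CSeq P1 P2) s1 s3
| cexec_loop0 i P s : s i = 0 -> cexec (CLoop i P) s s
| cexec_loop1 i P s k s1 s2 : s i = k.+1 -> cexec P (upd s i k) s1 ->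
    cexec (CLoop i P) s1 s2 -> cexec (CLoop i P) s s2.

(** The variant [k] need not be the loop register: in minimization the register holds a value of the
    function, while [k] is the distance to its least zero. *)
Lemma cexec_loop_inv i P (I : nat -> cstate -> Prop) :
  (forall s, I 0 s -> s i = 0) ->
  (forall k s, I k.+1 s ->
     0 < s i /\ exists2 s', cexec P (upd s i (s i).-1) s' & I k s') ->
  forall k s, I k s -> exists2 s', cexec (CLoop i P) s s' & I 0 s'.
Proof.
move=> I0 IS; elim=> [|k IHk] s Is; first by exists s => //; apply/cexec_loop0/I0.
have [gt0 [s1 ex1 /IHk[s2 ex2 Is2]]] := IS _ _ Is.
by exists s2 => //; apply: cexec_loop1 ex1 ex2; rewrite prednK.
Qed.

Definition agree F (s s' : cstate) := forall r, r < F -> s' r = s r.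

Lemma agree_trans F s1 s2 s3 : agree F s1 s2 -> agree F s2 s3 -> agree F s1 s3.
Proof. by move=> e12 e23 r lt_r; rewrite e23 ?e12. Qed.

Lemma agree_sub F F' s s' : F <= F' -> agree F' s s' -> agree F s s'.
Proof. by move=> le_F e r lt_r; apply: e; apply: leq_trans le_F. Qed.

Definition czero r := CLoop r CSkip.

Lemma cexec_zero r s : exists2 s', cexec (czero r) s s' &
  s' r = 0 /\ forall q, q != r -> s' q = s q.
Proof.
pose I k (s' : cstate) := s' r = k /\ forall q, q != r -> s' q = s q.
have [s' ex [s'r s'q]] : exists2 s', cexec (CLoop r CSkip) s s' & I 0 s'.
  apply: (@cexec_loop_inv _ _ I _ _ (s r)).
- by move=> s' [].
- move=> k s' [s'r s'q]; rewrite s'r; split=> //.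
  exists (upd s' r k); first exact: cexec_skip.
  split; first by rewrite /upd eqxx.
  by move=> q neq; rewrite /upd (negPf neq) s'q.
- by [].
by exists s'.
Qed.

(** Reading a register destroys it, so its content is moved to both [b] and [t], and [t] is then
    poured back into [a]. *)
Definition ccopy a b t :=
  CSeq (czero b) (CSeq (czero t)
    (CSeq (CLoop a (CSeq (CInc b) (CInc t))) (CLoop t (CInc a)))).

Lemma cexec_copy a b t s : [&& a != b, a != t & b != t] ->
  exists2 s', cexec (ccopy a b t) s s' &
    s' b = s a /\ forall q, q != b -> q != t -> s' q = s q.
Proof.
move=> /and3P[ab at_ bt]; have [s1 ex1 [s1b s1q]] := cexec_zero b s.
have [s2 ex2 [s2t s2q]] := cexec_zero t s1.
pose I k (s' : cstate) := [/\ s' a = k, s' b = s a - k, s' t = s a - k, k <= s a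
  & forall q, q != a -> q != b -> q != t -> s' q = s q].
have s2a : s2 a = s a by rewrite s2q // s1q.
have [s3 ex3 [s3a s3b s3t _ s3q]] :
    exists2 s', cexec (CLoop a (CSeq (CInc b) (CInc t))) s2 s' & I 0 s'.
  apply: (@cexec_loop_inv _ _ I _ _ (s a)).
- by move=> s' [].
- move=> k s' [s'a s'b s't le_k s'q]; rewrite s'a; split=> //=.
  eexists; first by apply: cexec_seq; apply: cexec_inc.
  rewrite /upd; split.
  + by rewrite (negPf at_) (negPf ab) eqxx.
  + by rewrite eqxx (negPf bt) !(eq_sym b) (negPf ab) s'b; lia.
  + by rewrite eqxx !(eq_sym t) (negPf bt) (negPf at_) s't; lia.
  + exact: ltnW.
  + by move=> q qa qb qt; rewrite (negPf qa) (negPf qb) (negPf qt) s'q.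
- split; rewrite ?subnn //; first by rewrite s2q // s1b.
  by move=> q _ qb qt; rewrite s2q // s1q.
pose J k (s' : cstate) := [/\ s' t = k, s' a = s a - k, s' b = s a, k <= s a
  & forall q, q != a -> q != b -> q != t -> s' q = s q].
have [s4 ex4 [s4t s4a s4b _ s4q]] : exists2 s', cexec (CLoop t (CInc a)) s3 s' & J 0 s'.
  apply: (@cexec_loop_inv _ _ J _ _ (s a)).
- by move=> s' [].
- move=> k s' [s't s'a s'b le_k s'q]; rewrite s't; split=> //=.
  eexists; first by apply: cexec_inc.
  rewrite /upd; split.
  + by rewrite eqxx (eq_sym t) (negPf at_).
  + by rewrite eqxx (negPf at_) s'a; lia.
  + by rewrite (negPf bt) (eq_sym b) (negPf ab) s'b.
  + exact: ltnW.
  + by move=> q qa qb qt; rewrite (negPf qa) (negPf qt) s'q.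
- by split; rewrite ?s3t ?s3a ?s3b ?subn0 ?subnn.
exists s4; last first.
  split=> // q qb qt; case: (eqVneq q a) => [->|qa]; last exact: s4q.
  by rewrite s4a subn0.
by apply: cexec_seq ex1 _; apply: cexec_seq ex2 _; apply: cexec_seq ex3 ex4.
Qed.

(* P writes f applied to the registers ins into register F, and may use all
   registers from F on as scratch space, whatever they contain. *)
Definition computes n (f : n.-tuple nat -> nat) (ins : 'I_n -> nat) F P :=
  forall s (x : n.-tuple nat), (forall i, tnth x i = s (ins i)) ->
  exists s', [/\ cexec P s s', agree F s s' & s' F = f x].

(** Arbitrary input registers and an arbitrary frame [F] make programs relocatable: in a composition
    each component runs above the results already stored. *)
Definition computable n (f : n.-tuple nat -> nat) :=
  forall (ins : 'I_n -> nat) F, (forall i, ins i < F) ->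
  exists P, computes f ins F P.

Lemma computable_comp m n (f : m.-tuple nat -> nat)
    (g : 'I_m -> n.-tuple nat -> nat) :
  computable f -> (forall i, computable (g i)) ->
  computable (fun x : n.-tuple nat => f [tuple g i x | i < m]).
Proof.
move=> Cf Cg ins F insF.
have [Q QP] : exists Q, forall s (x : n.-tuple nat), (forall i, tnth x i = s (ins i)) ->
    exists s', [/\ cexec Q s s', agree F s s' & forall j : 'I_m, s' (F + j) = g j x].
  have : forall k, k <= m -> exists Q, forall s (x : n.-tuple nat),
      (forall i, tnth x i = s (ins i)) ->
      exists s', [/\ cexec Q s s', agree F s s'
                   & forall j : 'I_m, j < k -> s' (F + j) = g j x].
    elim=> [_|k IHk lt_k].
      by exists CSkip => s x sx; exists s; split=> //; apply: cexec_skip.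
    have [Q QP] := IHk (ltnW lt_k).
    have [|P PP] := Cg (Ordinal lt_k) ins (F + k).
      by move=> i; apply: ltn_addr.
    exists (CSeq Q P) => s x sx; have [s1 [ex1 ag1 s1g]] := QP s x sx.
    have [|s2 [ex2 ag2 s2g]] := PP s1 x; first by move=> i; rewrite sx ag1.
    exists s2; split; first exact: cexec_seq ex1 ex2.
      by apply: agree_trans ag1 (agree_sub _ ag2); apply: leq_addr.
    move=> j; rewrite ltnS leq_eqVlt => /orP[/eqP ej|lt_j].
      by rewrite ej s2g; congr (g _ x); apply: val_inj.
    by rewrite ag2 ?s1g // ltn_add2l.
  move=> /(_ m (leqnn m)) [Q QP]; exists Q => s x /QP[s' [ex ag s'g]].
  by exists s'; split=> // j; apply: s'g.
have [|P PP] := Cf (fun i => F + i) (F + m).+1.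
  by move=> i; rewrite ltnS leq_add2l ltnW.
(* [Q] leaves the values of the [g j] in [F + j], so [f] works above them and its result is copied
   down to [F]. *)
exists (CSeq Q (CSeq P (ccopy (F + m).+1 F (F + m).+2))) => s x sx.
have [s1 [ex1 ag1 s1g]] := QP s x sx.
have [|s2 [ex2 ag2 s2g]] := PP s1 [tuple g i x | i < m].
  by move=> i; rewrite tnth_mktuple s1g.
have [s3 ex3 [s3F s3q]] := @cexec_copy ((F + m).+1) F (F + m).+2 s2 ltac:(lia).
exists s3; split; last by rewrite s3F.
  by apply: cexec_seq ex1 (cexec_seq ex2 ex3).
move=> r lt_r; rewrite s3q; try by apply/eqP; lia.
by rewrite ag2 ?ag1 //; lia.
Qed.

Lemma computable_prim n (f : n.-tuple nat -> nat) (g : n.+2.-tuple nat -> nat) :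
  computable f -> computable g ->
  computable (fun x : n.+1.-tuple nat =>
      let y : n.-tuple nat := [tuple of behead x] in
      iteri (thead x) (fun k r => g [tuple of [:: k, r & y]]) (f y)).
Proof.
move=> Cf Cg ins F insF.
have [|Pf PfP] := Cf (fun i => ins (lift ord0 i)) F; first by move=> i.
pose gins (i : 'I_n.+2) := if unlift ord0 i is Some j then
    if unlift ord0 j is Some k then ins (lift ord0 k) else F else F.+2.
have [|Pg PgP] := Cg gins F.+3.
  move=> i; rewrite /gins; case: unliftP => [j|] _ //.
  case: unliftP => [k|] _ //; last by lia.
  by have := insF (lift ord0 k); lia.
(* [F] is the accumulator, [F.+1] the number of rounds left and [F.+2] the index; [g] works from
   [F.+3] on. *)
exists (CSeq Pf (CSeq (ccopy (ins ord0) F.+1 F.+2) (CSeq (czero F.+2)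
  (CLoop F.+1 (CSeq Pg (CSeq (ccopy F.+3 F F.+4) (CInc F.+2))))))) => s x sx.
pose y : n.-tuple nat := [tuple of behead x].
pose G k r := g [tuple of [:: k, r & y]].
have insF0 := insF ord0.
have [|s1 [ex1 ag1 s1F]] := PfP s y.
  move=> i; rewrite tnth_behead -sx; congr tnth.
  by apply: val_inj; rewrite /= inordK // ltnS.
have [s2 ex2 [s2c s2q]] := @cexec_copy (ins ord0) F.+1 F.+2 s1 ltac:(lia).
have [s3 ex3 [s3k s3q]] := cexec_zero F.+2 s2.
pose I k (s' : cstate) := [/\ s' F.+1 = k, s' F.+2 = thead x - k, k <= thead x,
  s' F = iteri (thead x - k) G (f y) & agree F s s'].
have [s4 ex4 [_ _ _ s4F s4q]] : exists2 s',
    cexec (CLoop F.+1 (CSeq Pg (CSeq (ccopy F.+3 F F.+4) (CInc F.+2)))) s3 s'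
    & I 0 s'.
  apply: (@cexec_loop_inv _ _ I _ _ (thead x)).
- by move=> s' [].
- move=> k s' [s'c s'k le_k s'F ag]; rewrite s'c; split=> //=; set s'' := upd _ _ _.
  have [|t1 [ext1 agt1 t1F]] := PgP s'' [tuple of [:: thead x - k.+1, s' F & y]].
    move=> i; rewrite /gins /s'' /upd.
    case: unliftP => [j ->|->]; last first.
      by rewrite s'k (tnth_nth 0) /= ifF //; apply/eqP; lia.
    case: unliftP => [l ->|->]; last first.
      by rewrite (tnth_nth 0) /= ifF //; apply/eqP; lia.
    have lt_l := insF (lift ord0 l).
    rewrite ifF; last by apply/eqP; lia.
    by rewrite (ag _ lt_l) -sx !(tnth_nth 0) /= nth_behead.
  have [t2 ext2 [t2F t2q]] := @cexec_copy F.+3 F F.+4 t1 ltac:(lia).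
  have s''E r : r != F.+1 -> s'' r = s' r by move=> /negPf ne; rewrite /s'' /upd ne.
  eexists; first by apply: cexec_seq ext1 (cexec_seq ext2 _); apply: cexec_inc.
  rewrite /upd; split.
  + rewrite ifF; last by apply/eqP; lia.
    rewrite t2q; try by apply/eqP; lia.
    by rewrite agt1 ?ltnS // /s'' /upd eqxx.
  + rewrite eqxx t2q; try by apply/eqP; lia.
    rewrite agt1 ?ltnS // s''E; last by apply/eqP; lia.
    by rewrite s'k; lia.
  + exact: ltnW.
  + rewrite ifF; last by apply/eqP; lia.
    rewrite t2F t1F s'F; have -> : thead x - k = (thead x - k.+1).+1 by lia.
    by [].
  + move=> r lt_r; rewrite ifF; last by apply/eqP; lia.
    rewrite t2q; try by apply/eqP; lia.
    rewrite agt1; last by lia.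
    by rewrite s''E ?ag //; apply/eqP; lia.
- split; rewrite ?subnn //.
  + rewrite s3q; last by apply/eqP; lia.
    by rewrite s2c ag1 // -sx; congr tnth.
  + rewrite s3q; last by apply/eqP; lia.
    by rewrite s2q ?s1F //; apply/eqP; lia.
  + move=> r lt_r; rewrite s3q; last by apply/eqP; lia.
    by rewrite s2q ?ag1 //; apply/eqP; lia.
exists s4; split=> //; last by rewrite s4F subn0.
by apply: cexec_seq ex1 (cexec_seq ex2 (cexec_seq ex3 ex4)).
Qed.

Lemma computable_min n (f : n.+1.-tuple nat -> nat) (h : n.-tuple nat -> nat) :
  computable f ->
  (forall x : n.-tuple nat, f [tuple of h x :: x] = 0 /\
     forall k, k < h x -> f [tuple of k :: x] <> 0) ->
  computable h.
Proof.
move=> Cf hP ins F insF.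
pose fins (i : 'I_n.+1) := if unlift ord0 i is Some j then ins j else F.
have [|P PP] := Cf fins F.+1.
  by move=> i; rewrite /fins; case: unliftP => [j|] _ //; have := insF j; lia.
(* [F] is the candidate and [F.+1] the value of [f] there. The loop spoils [F.+1] by its decrement,
   but the body recomputes it for the next candidate. *)
exists (CSeq (czero F) (CSeq P (CLoop F.+1 (CSeq (CInc F) P)))) => s x sx.
have PP' s' : agree F s s' -> exists s'', [/\ cexec P s' s'', agree F.+1 s' s''
    & s'' F.+1 = f [tuple of s' F :: x]].
  move=> ag; apply: PP => i; rewrite /fins; case: unliftP => [j ->|->].
    by rewrite (ag _ (insF j)) -sx !(tnth_nth 0) /=.
  by rewrite (tnth_nth 0).
have [s1 ex1 [s1F s1q]] := cexec_zero F s.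
have ag1 : agree F s s1 by move=> r lt_r; rewrite s1q //; apply/eqP; lia.
have [s2 [ex2 ag2 s2f]] := PP' s1 ag1.
pose I k (s' : cstate) := [/\ s' F + k = h x, s' F.+1 = f [tuple of s' F :: x]
  & agree F s s'].
have [s3 ex3 [s3F _ s3q]] :
    exists2 s', cexec (CLoop F.+1 (CSeq (CInc F) P)) s2 s' & I 0 s'.
  apply: (@cexec_loop_inv _ _ I _ _ (h x)).
- by move=> s' []; rewrite addn0 => e -> _; rewrite e; case: (hP x).
- move=> k s' [s'F s'f ag]; have [_ /(_ (s' F)) ne] := hP x.
  split; first by rewrite s'f lt0n; apply/eqP/ne; lia.
  set s'' := upd _ F.+1 _; pose s3 := upd s'' F (s'' F).+1.
  have s''F : s'' F = s' F by rewrite /s'' /upd ifF //; apply/eqP; lia.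
  have s3F : s3 F = (s' F).+1 by rewrite /s3 /upd eqxx s''F.
  have ag3 : agree F s s3.
    by move=> r lt_r; rewrite /s3 /s'' /upd !ifF ?ag //; apply/eqP; lia.
  have [s4 [ex4 ag4 s4f]] := PP' s3 ag3.
  exists s4; first by apply: cexec_seq ex4; apply: cexec_inc.
  have s4F : s4 F = (s' F).+1 by rewrite ag4.
  split; first by rewrite s4F; lia.
    by rewrite s4f s4F s3F.
  by apply: agree_trans ag3 (agree_sub _ ag4).
- have s2F : s2 F = s1 F by rewrite ag2.
  split; rewrite ?s2F ?s1F ?s2f ?s1F //.
  by apply: agree_trans ag1 (agree_sub _ ag2).
exists s3; split=> //; last by rewrite -s3F addn0.
by apply: cexec_seq ex1 (cexec_seq ex2 ex3).
Qed.

Lemma recursive_computable n (f : n.-tuple nat -> nat) :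
  recursive f -> computable f.
Proof.
elim=> {n f}.
- move=> n ins F _; exists (czero F) => s x _.
  have [s' ex [s'F s'q]] := cexec_zero F s; exists s'; split=> // r lt_r.
  by rewrite s'q //; apply/eqP; lia.
- move=> ins F insF; exists (CSeq (ccopy (ins ord0) F F.+1) (CInc F)) => s x sx.
  have insF0 := insF ord0.
  have [s' ex [s'F s'q]] := @cexec_copy (ins ord0) F F.+1 s ltac:(lia).
  eexists; split; first by apply: cexec_seq ex _; apply: cexec_inc.
    by move=> r lt_r; rewrite /upd ifF ?s'q //; apply/eqP; lia.
  by rewrite /upd eqxx s'F -sx.
- move=> n i ins F insF; exists (ccopy (ins i) F F.+1) => s x sx.
  have insF0 := insF i.
  have [s' ex [s'F s'q]] := @cexec_copy (ins i) F F.+1 s ltac:(lia).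
  exists s'; split=> //; last by rewrite s'F.
  by move=> r lt_r; rewrite s'q //; apply/eqP; lia.
- by move=> m n f g _ Cf _; apply: computable_comp.
- by move=> n f g _ Cf _; apply: computable_prim.
- by move=> n f h _ Cf; apply: computable_min.
- move=> n f g e _ Cf ins F /Cf[P PP]; exists P => s x /PP[s' [ex ag s'F]].
  by exists s'; rewrite -e.
Qed.

(** * Queue programs *)

(* [QStep w] drops the head of the queue and enqueues w; [QWhile P] runs P as
   long as the head is true. *)
Inductive qprog := QSkip | QStep of seq bool | QSeq of qprog & qprog
  | QWhile of qprog.

(* The third argument lists the words that are enqueued during the run. *)
Inductive qexec : qprog -> seq bool -> seq (seq bool) -> seq bool -> Prop :=
| qexec_skip q : qexec QSkip q [::] q
| qexec_step w b q : qexec (QStep w) (b :: q) [:: w] (q ++ w)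
| qexec_seq P1 P2 q1 ws1 q2 ws2 q3 :
    qexec P1 q1 ws1 q2 -> qexec P2 q2 ws2 q3 ->
    qexec (QSeq P1 P2) q1 (ws1 ++ ws2) q3
| qexec_while0 P q : qexec (QWhile P) (false :: q) [::] (false :: q)
| qexec_while1 P q ws1 q1 ws2 q2 :
    qexec P (true :: q) ws1 q1 -> qexec (QWhile P) q1 ws2 q2 ->
    qexec (QWhile P) (true :: q) (ws1 ++ ws2) q2.

Lemma qexec_det P q ws q1 ws' q2 :
  qexec P q ws q1 -> qexec P q ws' q2 -> q1 = q2.
Proof.
move=> ex; elim: ex ws' q2 => {P q ws q1}.
- by move=> q ws' q2 ex; inversion ex.
- by move=> w b q ws' q2 ex; inversion ex.
- move=> P1 P2 q1 ws1 q2 ws2 q3 _ IH1 _ IH2 ws' q' ex; inversion ex; subst.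
  match goal with H1 : qexec P1 _ _ _, H2 : qexec P2 _ _ _ |- _ =>
    by rewrite -(IH1 _ _ H1) in H2; apply: IH2 H2 end.
- by move=> P q ws' q2 ex; inversion ex.
- move=> P q ws1 q1 ws2 q2 _ IH1 _ IH2 ws' q' ex; inversion ex; subst.
  match goal with H1 : qexec P _ _ _, H2 : qexec (QWhile P) _ _ _ |- _ =>
    by rewrite -(IH1 _ _ H1) in H2; apply: IH2 H2 end.
Qed.

Fixpoint words (P : qprog) : seq (seq bool) :=
  match P with
  | QSkip => [::]
  | QStep w => [:: w]
  | QSeq P1 P2 => words P1 ++ words P2
  | QWhile P1 => words P1
  end.

Lemma qexec_words P q ws q' : qexec P q ws q' -> {subset ws <= words P}.
Proof.
elim=> {P q ws q'} [q|w b q|P1 P2 q1 ws1 q2 ws2 q3 _ IH1 _ IH2|P q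
  |P q ws1 q1 ws2 q2 _ IH1 _ IH2] v //=.
  by rewrite !mem_cat => /orP[/IH1->|/IH2->]; rewrite ?orbT.
by rewrite mem_cat => /orP[/IH1|/IH2].
Qed.

Definition run P q q' := exists ws, qexec P q ws q'.

Lemma run_seq P1 P2 q1 q2 q3 : run P1 q1 q2 -> run P2 q2 q3 ->
  run (QSeq P1 P2) q1 q3.
Proof.
by move=> [ws1 ex1] [ws2 ex2]; exists (ws1 ++ ws2); apply: qexec_seq ex1 ex2.
Qed.

Lemma run_step w b q : run (QStep w) (b :: q) (q ++ w).
Proof. by exists [:: w]; apply: qexec_step. Qed.

Lemma run_while1 P q q1 q2 : run P (true :: q) q1 -> run (QWhile P) q1 q2 ->
  run (QWhile P) (true :: q) q2.
Proof.
by move=> [ws1 ex1] [ws2 ex2]; exists (ws1 ++ ws2); apply: qexec_while1 ex1 ex2.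
Qed.

Lemma run_det P q q1 q2 : run P q q1 -> run P q q2 -> q1 = q2.
Proof. by move=> [ws1 ex1] [ws2 ex2]; apply: qexec_det ex1 ex2. Qed.

Definition qpow k P := iter k (QSeq P) QSkip.
Arguments qpow : simpl never.

Definition unary (l : seq nat) : seq bool :=
  flatten [seq rcons (nseq x true) false | x <- l].

Lemma unary_cat l l' : unary (l ++ l') = unary l ++ unary l'.
Proof. by rewrite /unary map_cat flatten_cat. Qed.

Lemma unary_cons x l : unary (x :: l) = nseq x true ++ false :: unary l.
Proof. by rewrite /unary /= -cats1 -catA. Qed.

Definition qcopy := QWhile (QStep [:: true]).

Lemma run_copy x q : run qcopy (nseq x true ++ false :: q) (false :: q ++ nseq x true).
Proof.
elim: x q => [|x IHx] q /=.
  by rewrite cats0; exists [::]; apply: qexec_while0.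
apply: run_while1; first exact: run_step.
rewrite -catA cat_cons; have := IHx (q ++ [:: true]).
by rewrite -catA.
Qed.

Definition qrot := QSeq qcopy (QStep [:: false]).

Lemma run_rot x l : run qrot (unary (x :: l)) (unary (rcons l x)).
Proof.
rewrite unary_cons; apply: run_seq; first exact: run_copy.
rewrite -cats1 unary_cat unary_cons /= catA.
exact: run_step.
Qed.

Definition qinc := QSeq qcopy (QStep [:: true; false]).

Lemma run_inc x l : run qinc (unary (x :: l)) (unary (rcons l x.+1)).
Proof.
rewrite unary_cons; apply: run_seq; first exact: run_copy.
rewrite -cats1 unary_cat unary_cons -addn1 nseqD -catA /= catA.
exact: run_step.
Qed.

(* A queue cannot shrink, so a register is decremented by moving a unit to the
   block in front of it. *)
Definition qmove := QSeq qcopy (QSeq (QStep [:: true])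
  (QSeq (QStep [:: false]) (QSeq qcopy (QStep [:: false])))).

(** A delimiter and a unit trade places: one step drops the delimiter of the first block and
    enqueues true, the next drops a true of the second block and enqueues the delimiter. *)
Lemma run_move x y l :
  run qmove (unary [:: x, y.+1 & l]) (unary (l ++ [:: x.+1; y])).
Proof.
rewrite unary_cons unary_cons; apply: run_seq; first exact: run_copy.
apply: run_seq; first exact: run_step.
rewrite /= -!catA /=; apply: run_seq; first exact: run_step.
rewrite -!catA /=; apply: run_seq; first exact: run_copy.
rewrite unary_cat !unary_cons -[x.+1]addn1 nseqD /=.
set q := (_ ++ nseq y true); suff -> : unary l ++ (nseq x true ++ [:: true]) ++
   false :: nseq y true ++ [:: false] = q ++ [:: false] by exact: run_step.
by rewrite /q -!catA.
Qed.

Lemma run_rots l l' : run (qpow (size l) qrot) (unary (l ++ l')) (unary (l' ++ l)).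
Proof.
elim: l l' => [|x l IHl] l'; first by rewrite cats0; exists [::]; apply: qexec_skip.
apply: run_seq; first exact: run_rot.
by rewrite rcons_cat -cat_rcons; apply: IHl.
Qed.

(** * Simulation of counter programs *)

(* Register i < N is the block 2 i + 1; the block 2 i absorbs what is removed
   from it. *)
Fixpoint cq N (P : cprog) : qprog :=
  match P with
  | CSkip => QSkip
  | CInc i => QSeq (qpow i.*2.+1 qrot) (QSeq qinc (qpow (N.*2 - i.*2.+2) qrot))
  | CSeq P1 P2 => QSeq (cq N P1) (cq N P2)
  | CLoop i P =>
      QSeq (qpow i.*2.+1 qrot)
        (QSeq (QWhile
           (QSeq (qpow (N.*2 - i.*2.+1) qrot)
             (QSeq (qpow i.*2 qrot)
               (QSeq qmove
                 (QSeq (qpow (N.*2 - i.*2.+2) qrot)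
                   (QSeq (cq N P) (qpow i.*2.+1 qrot)))))))
          (qpow (N.*2 - i.*2.+1) qrot))
  end.

Fixpoint regs_below N P :=
  match P with
  | CSkip => true
  | CInc i => i < N
  | CSeq P1 P2 => regs_below N P1 && regs_below N P2
  | CLoop i P1 => (i < N) && regs_below N P1
  end.

Lemma regs_below_exists P : exists N0, forall N, N0 <= N -> regs_below N P.
Proof.
elim: P => [|i|P1 [N1 IH1] P2 [N2 IH2]|i P [N0 IHP]] /=.
- by exists 0.
- by exists i.+1.
- by exists (N1 + N2) => N le; rewrite IH1 ?IH2 //; lia.
- by exists (i.+1 + N0) => N le; rewrite IHP //; lia.
Qed.

Definition represents N (s : cstate) l :=
  size l = N.*2 /\ forall i, i < N -> nth 0 l i.*2.+1 = s i.

Lemma represents_split N s l i : represents N s l -> i < N ->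
  exists A x B, [/\ l = A ++ [:: x, s i & B], size A = i.*2
    & size B = N.*2 - i.*2.+2].
Proof.
move=> [sz val] lt_i; exists (take i.*2 l), (nth 0 l i.*2), (drop i.*2.+2 l).
split; last by rewrite size_drop sz.
  by rewrite -val // -!drop_nth ?sz ?cat_take_drop //; lia.
by rewrite size_takel // sz leq_double ltnW.
Qed.

Lemma represents_upd N s A x y B i k :
  represents N s (A ++ [:: x, s i & B]) -> size A = i.*2 ->
  represents N (upd s i k) (A ++ [:: y, k & B]).
Proof.
move=> [sz val] szA; split=> [|j lt_j]; first by rewrite -sz !size_cat.
have := val j lt_j; rewrite /upd !nth_cat szA.
case: ltnP => lt_ij; first by case: eqP => // e; lia.
have [->|ne] := eqVneq j i; first by rewrite subSn // subnn.
have -> : j.*2.+1 - i.*2 = (j.*2.+1 - i.*2 - 2).+2 by lia.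
by [].
Qed.

Definition loop_body N i P :=
  QSeq (qpow (N.*2 - i.*2.+1) qrot)
    (QSeq (qpow i.*2 qrot)
      (QSeq qmove
        (QSeq (qpow (N.*2 - i.*2.+2) qrot)
          (QSeq (cq N P) (qpow i.*2.+1 qrot))))).

(** The queue at a loop test, rotated so that the block of register [i] comes first. Its leading bit
    is true exactly if the register is positive, and this bit is all that [QWhile] sees. *)
Definition at_register N i s l q :=
  [/\ represents N s l, run (qpow i.*2.+1 qrot) (unary l) q,
      run (qpow (N.*2 - i.*2.+1) qrot) q (unary l)
    & exists q', q = nseq (s i) true ++ false :: q'].

Lemma run_to_register N s l i : represents N s l -> i < N ->
  exists q, at_register N i s l q.
Proof.
move=> rep lt_i; have [A [x [B [lE szA szB]]]] := represents_split rep lt_i.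
exists (unary (s i :: B ++ rcons A x)); split=> //; last first.
- by rewrite unary_cons; exists (unary (B ++ rcons A x)).
- have sz : size (s i :: B) = N.*2 - i.*2.+1 by rewrite /= szB; lia.
  by have := run_rots (s i :: B) (rcons A x); rewrite sz cat_rcons -lE.
- have := run_rots (rcons A x) (s i :: B).
  by rewrite size_rcons szA cat_rcons -lE.
Qed.

Definition simulates N P s s' := forall l, represents N s l ->
  exists2 l', run (cq N P) (unary l) (unary l') & represents N s' l'.

Lemma run_loop_body N i P s l q k s1 :
  at_register N i s l q -> i < N -> s i = k.+1 ->
  simulates N P (upd s i k) s1 ->
  exists l1 q1, run (loop_body N i P) q q1 /\ at_register N i s1 l1 q1.
Proof.
move=> [rep _ back _] lt_i sik sim.
have [A [x [B [lE szA szB]]]] := represents_split rep lt_i.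
have rep' : represents N (upd s i k) (A ++ [:: x.+1, k & B]).
  by rewrite lE in rep; apply: represents_upd rep szA.
have [l1 runP rep1] := sim _ rep'.
have [q1 at1] := run_to_register rep1 lt_i.
exists l1, q1; split=> //; have [_ to1 _ _] := at1.
apply: run_seq back _; rewrite lE sik -{1}szA.
apply: run_seq; first exact: run_rots.
apply: run_seq; first exact: run_move.
rewrite -catA -szB; apply: run_seq; first exact: run_rots.
by apply: run_seq to1; rewrite -catA.
Qed.

Lemma run_seq_inv P1 P2 q q2 : run (QSeq P1 P2) q q2 ->
  exists2 q1, run P1 q q1 & run P2 q1 q2.
Proof.
case=> ws ex; inversion ex as [| |? ? ? ws1 q1 ws2 ? ex1 ex2| |]; subst.
by exists q1; [exists ws1 | exists ws2].
Qed.

Lemma cexec_simulates N P s s' :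
  cexec P s s' -> regs_below N P -> simulates N P s s'.
Proof.
elim=> {P s s'} /=.
- by move=> s _ l rep; exists l => //; exists [::]; apply: qexec_skip.
- move=> i s lt_i l rep.
  have [A [x [B [lE szA szB]]]] := represents_split rep lt_i.
  exists (A ++ [:: x, (s i).+1 & B]); last first.
    by rewrite lE in rep; apply: represents_upd rep szA.
  rewrite /= lE -szB -!(cat_rcons x).
  have -> : i.*2.+1 = size (rcons A x) by rewrite size_rcons szA.
  apply: run_seq; first exact: run_rots.
  apply: run_seq; first exact: run_inc.
  by rewrite rcons_cat -(cat_rcons (s i).+1); apply: run_rots.
- move=> P1 P2 s1 s2 s3 _ IH1 _ IH2 /andP[/IH1 sim1 /IH2 sim2] l /sim1[l1 run1].
  by move=> /sim2[l2 run2 rep2]; exists l2 => //; apply: run_seq run1 run2.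
- move=> i P s s0 /andP[lt_i _] l rep.
  have [q [_ to back [q' qE]]] := run_to_register rep lt_i.
  exists l => //; apply: run_seq to (run_seq _ back).
  by rewrite qE s0; exists [::]; apply: qexec_while0.
- move=> i P s k s1 s2 sik _ IH1 _ IH2 /[dup] reg /andP[lt_i regP] l rep.
  have [q at0] := run_to_register rep lt_i.
  have [l1 [q1 [body [rep1 to1 _ _]]]] := run_loop_body at0 lt_i sik (IH1 regP).
  (* The induction hypothesis runs the whole loop from the unrotated queue. Determinism identifies
     its initial rotation with the end of the body just run, so the two parts of the loop join. *)
  have [l2 /run_seq_inv[q1' to1' /run_seq_inv[q2 loop back]] rep2] := IH2 reg _ rep1.
  rewrite -(run_det to1 to1') in loop.
  exists l2 => //; have [_ to _ [q' qE]] := at0.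
  apply: run_seq to (run_seq _ back).
  by rewrite qE sik in body *; apply: run_while1 body loop.
Qed.

(** By determinism every iteration of a supposed finite run is the simulated one, which restores [I]
    and leaves register [i] positive; induction on the run excludes its exit. *)
Lemma loop_diverges N i P (I : cstate -> Prop) :
  i < N -> regs_below N P ->
  (forall s, I s ->
     exists2 k, s i = k.+1 & exists2 s', cexec P (upd s i k) s' & I s') ->
  forall s l q, represents N s l -> I s ->
    ~ run (cq N (CLoop i P)) (unary l) q.
Proof.
move=> lt_i regP step s l q rep Is /run_seq_inv[q0 to /run_seq_inv[q1 [ws ex] _]].
have [q0' at0] := run_to_register rep lt_i.
have {to} e : q0 = q0' by have [_ to' _ _] := at0; apply: run_det to to'.
rewrite -{q0'}e in at0; move eP: (QWhile _) ex => P' ex.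
elim: ex eP s l Is rep at0 => // {P' q0 ws q1}.
- move=> P' q' _ s l Is _ [_ _ _ [q1 qE]].
  by have [k sik _] := step s Is; rewrite sik in qE.
- move=> P' q' ws1 q1 ws2 q2 ex1 _ _ IH [eP] s l Is _ at0.
  have [k sik [s1 exP Is1]] := step s Is.
  have [l1 [q1' [body at1]]] :=
    run_loop_body at0 lt_i sik (cexec_simulates exP regP).
  have e : q1 = q1'.
    by apply: run_det body; exists ws1; rewrite /loop_body eP.
  rewrite -e in at1; have [rep1 _ _ _] := at1.
  by apply: (IH _ s1 l1) => //; rewrite -eP.
Qed.

(** * Queue programs as terms *)

(* The states of a run are the points of a path along [t_next], labelled by the
   bits that enter the queue: a state is the position of the head of the queue,
   and [t_tail] maps it to the position of the end of the queue. The actions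
   [t_prev] and [t_head] are made to invert them where this is needed. *)
Definition t_bit b := TVar (PTest (0, b)).
Definition t_next := TVar (Action 0).
Definition t_prev := TVar (Action 1).
Definition t_tail := TVar (Action 2).
Definition t_head := TVar (Action 3).

Fixpoint t_word (w : seq bool) : term :=
  if w is b :: w' then TSeq (t_bit b) (TSeq t_next (t_word w')) else TI.

(** From [a] the walk goes to [tail a], reads [w] up to some [x], and returns by [head] to some [b]
    and by [prev] to [a]. The inner loops give [tail b = x] and [next a = b]; together, [tail] maps
    [next a] to [x]. The final [t_next] moves the head of the queue. *)
Definition t_step w :=
  TSeq (tloop (TSeq t_tail (TSeq (t_word w) (TSeq (tloop (TSeq t_head t_tail))
         (TSeq t_head (TSeq (tloop (TSeq t_prev t_next)) t_prev))))))
    t_next.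

Definition t_init q :=
  tloop (TSeq (t_word q) (TSeq (tloop (TSeq t_head t_tail)) t_head)).

Fixpoint t_prog (P : qprog) : term :=
  match P with
  | QSkip => TI
  | QStep w => t_step w
  | QSeq P1 P2 => TSeq (t_prog P1) (t_prog P2)
  | QWhile P1 => twhile (t_bit true) (t_prog P1)
  end.

Lemma is_test_bit b : is_test (t_bit b).
Proof. by constructor. Qed.

Lemma PWP_word w : PWP_loop (t_word w).
Proof.
elim: w => [|b w IHw] /=; first by do 2 constructor.
by apply: PWP_seq; [apply/PWP_test/is_test_bit | apply: PWP_seq => //; constructor].
Qed.

Lemma PWP_step w : PWP_loop (t_step w).
Proof.
by repeat (apply: PWP_seq || apply: PWP_tloop || apply: PWP_word || constructor).
Qed.

Lemma PWP_init q : PWP_loop (t_init q).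
Proof.
by repeat (apply: PWP_seq || apply: PWP_tloop || apply: PWP_word || constructor).
Qed.

Lemma PWP_prog P : PWP_loop (t_prog P).
Proof.
elim: P => [|w|P1 IH1 P2 IH2|P IHP]; first by do 2 constructor.
- exact: PWP_step.
- exact: PWP_seq.
- by apply: PWP_while => //; apply: is_test_bit.
Qed.

Definition allowed_var (x : var) : bool :=
  match x with PTest p => p.1 == 0 | Action a => a < 4 end.

Lemma allowed_word w : all allowed_var (vars (t_word w)).
Proof. by elim: w. Qed.

Lemma allowed_step w : all allowed_var (vars (t_step w)).
Proof. by rewrite /= !cats0 !all_cat allowed_word. Qed.

Lemma allowed_init q : all allowed_var (vars (t_init q)).
Proof. by rewrite /= !cats0 !all_cat allowed_word. Qed.

Lemma allowed_prog P : all allowed_var (vars (t_prog P)).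
Proof.
elim: P => [|w|P1 IH1 P2 IH2|P IHP] //; first exact: allowed_step.
  by rewrite /= all_cat IH1 IH2.
by rewrite /= all_cat IHP.
Qed.

Lemma fragment_allowed t p : PWP_loop t -> all allowed_var (vars t) ->
  p \in ptests t -> fragment t.
Proof.
move=> Pt al pP; split=> //.
  rewrite /num_actions -(size_iota 0 4) uniq_leq_size ?undup_uniq // => a.
  rewrite mem_undup mem_pmap_has mem_iota.
  by elim: (vars t) al => //= x s IHs /andP[al_x /IHs {}IHs] /orP[|//];
    case: x al_x => // b lt_b /eqP[<-].
have pE j : (j \in ptests t) -> j = 0.
  rewrite mem_pmap_has.
  by elim: (vars t) al => //= x s IHs /andP[al_x /IHs {}IHs] /orP[|//];
    case: x al_x => // b /eqP b0 /eqP[<-].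
apply/eqP; rewrite eqn_leq; apply/andP; split.
  apply: (@uniq_leq_size _ _ [:: 0]); first exact: undup_uniq.
  by move=> j; rewrite mem_undup inE => /pE->.
by rewrite lt0n size_eq0; apply: contraTneq pP => e; rewrite -mem_undup /ptests e.
Qed.

(** * From a model of the term to a run of the program *)

Section Soundness.
Variables (B : Type) (v : valuation B).
Hypothesis vP : DREL_test v.

Let vfun x a b c : v x a b -> v x a c -> b = c.
Proof. by case: vP => _ h _ _; apply: h. Qed.

Lemma eval_bit b a c : eval v (t_bit b) a c -> a = c.
Proof. by case: vP => _ _ h _; apply: h. Qed.

Lemma eval_bit_inj b b' a : eval v (t_bit b) a a -> eval v (t_bit b') a a -> b = b'.
Proof.
case: vP => _ _ _ h; have := (h (0, b) a a).1.
by rewrite /ptest_compl /=; case: b b' => [] [] //= H e1 e2;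
  have [] := H _.
Qed.

Lemma eval_word_cat w w' a b c :
  eval v (t_word w) a b -> eval v (t_word w') b c -> eval v (t_word (w ++ w')) a c.
Proof.
elim: w a => [|d w IHw] a /=; first by move=> ->.
by move=> [a1 ea1 [a2 ea2 ew]] ew'; exists a1 => //; exists a2 => //; apply: IHw ew ew'.
Qed.

(** The queue is stored nowhere: it is the word of labels between a point and its image under
    [tail]. *)
Definition holds a q := exists2 x, v (Action 2) a x & eval v (t_word q) a x.

Lemma holds_head a b q : holds a (b :: q) -> eval v (t_bit b) a a.
Proof.
by move=> [x _ /= [a' ea _]]; move: (ea); rewrite -(eval_bit ea).
Qed.

Lemma eval_init q a b : eval v (t_init q) a b -> a = b /\ holds a q.
Proof.
move=> [] /= [x ew [x' [[y hx ty] e1] hx']] e; subst b x'; split=> //.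
by exists x => //; rewrite -(vfun hx hx').
Qed.

Lemma eval_step w b q a c : eval v (t_step w) a c -> holds a (b :: q) ->
  holds c (q ++ w).
Proof.
move=> [a' [/= [x ta [x2 ew [x2' [[y hx2 ty] e1] [y' hx2'
  [y'' [[z my nz] e2] my']]]]] e3] na].
subst x2' y'' a'; move=> [x' ta' /= [a1 ea [a2 na1 ew']]].
have ea1 := eval_bit ea; subst a1.
have e4 := vfun na1 na; subst a2.
have e5 := vfun ta' ta; subst x'.
have e6 := vfun hx2 hx2'; subst y'.
have e7 := vfun my my'; subst z.
(* [y] is the point reached by [head]; once it is identified with [c], the fact about [tail] at [y]
   becomes the one wanted at [c]. *)
have e8 := vfun nz na; subst y.
by exists x2 => //; apply: eval_word_cat ew' ew.
Qed.

(** Nonempty enqueued words keep the queue nonempty, and then the label of the current point is the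
    head of the queue, so the term and the program take the same branches. *)
Lemma eval_prog P a b q : eval v (t_prog P) a b -> [::] \notin words P ->
  holds a q -> q != [::] ->
  exists q', [/\ run P q q', holds b q' & q' != [::]].
Proof.
elim: P a b q => [|w|P1 IH1 P2 IH2|P IHP] a b q.
- by move=> /= <- _ ha q0; exists q; split=> //; exists [::]; apply: qexec_skip.
- move=> es; rewrite /= inE eq_sym => w0; case: q => // c q ha _.
  exists (q ++ w); split; [exact: run_step | exact: eval_step es ha|].
  by rewrite -size_eq0 size_cat addn_eq0 !size_eq0 (negPf w0) andbF.
- move=> /= [c e1 e2]; rewrite mem_cat negb_or => /andP[w1 w2] ha q0.
  have [q1 [run1 hc q10]] := IH1 _ _ _ e1 w1 ha q0.
  have [q2 [run2 hb q20]] := IH2 _ _ _ e2 w2 hc q10.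
  by exists q2; split=> //; apply: run_seq run1 run2.
- move=> [b' es eb]; have e := eval_bit eb; subst b'; move=> w0.
  move: es; rewrite /= => /clos_rt_rt1n_iff es.
  elim: es q eb => {a b} [a|a c b [a' ea ec] _ IH] q eb ha q0.
    case: q ha q0 => // d q ha _; exists (d :: q); split=> //.
    rewrite -(eval_bit_inj eb (holds_head ha)).
    by exists [::]; apply: qexec_while0.
  have e := eval_bit ea; subst a'.
  case: q ha q0 => // d q ha _.
  have e := eval_bit_inj ea (holds_head ha); subst d.
  have [q1 [run1 hc q10]] := IHP _ _ _ ec w0 ha isT.
  have [q2 [run2 hb q20]] := IH _ eb hc q10.
  by exists q2; split=> //; apply: run_while1 run1 run2.
Qed.
End Soundness.

Lemma size_flatten_geq (s : seq (seq bool)) :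
  [::] \notin s -> size s <= size (flatten s).
Proof.
elim: s => // w s IH; rewrite inE negb_or eq_sym -size_eq0 -lt0n.
rewrite -[flatten _]/(w ++ flatten s) size_cat -[size (w :: _)]/(1 + size s).
by move=> /andP[w0 /IH le]; rewrite leq_add.
Qed.

(** * From a run of the program to a finite model *)

Section Completeness.
Variables (q0 : seq bool) (ws : seq (seq bool)).
Hypothesis ws0 : [::] \notin ws.
Let W := q0 ++ flatten ws.
(** Each step drops one bit, so after [i] steps the head of the queue is at position [i], and its
    end at [T i]. *)
Let T i := size q0 + size (flatten (take i ws)).

(** [tail] and [head] are cut at the last state: beyond it [T] is constant and [head] could fail to
    be functional. Up to it [T] is strictly increasing, as no enqueued word is empty. *)
Definition run_val : valuation 'I_(size W).+1 := fun x a b =>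
  match x with
  | PTest (_, c) => a = b /\ nth false W a = c
  | Action 0 => b = a.+1 :> nat
  | Action 1 => a = b.+1 :> nat
  | Action 2 => a <= size ws /\ b = T a :> nat
  | Action 3 => b <= size ws /\ a = T b :> nat
  | _ => False
  end.

Let T_lt i j : i < j <= size ws -> T i < T j.
Proof.
elim: j => // j IHj; rewrite ltnS => /andP[le_ij lt_j].
have lt_T : T j < T j.+1.
  rewrite /T (take_nth [::]) // flatten_rcons size_cat.
  rewrite addnA -[ltnLHS]addn0 ltn_add2l lt0n size_eq0.
  by apply: contraNneq ws0 => <-; apply: mem_nth.
case: (ltngtP i j) le_ij => // [lt_ij _|-> //].
by apply: ltn_trans (IHj _) lt_T; rewrite lt_ij ltnW.
Qed.

Lemma run_val_DREL : DREL_test run_val.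
Proof.
split.
- by split; exact: ord0.
- move=> [[i c]|[|[|[|[|k]]]]] a b c' //=.
  + by move=> [<- _] [<- _].
  + by move=> eb ec; apply: val_inj; rewrite /= eb ec.
  + by move=> eb [ec]; apply: val_inj; move: eb; rewrite ec => -[].
  + by move=> [_ eb] [_ ec]; apply: val_inj; rewrite /= eb ec.
  + move=> [le_b eb] [le_c ec]; apply: val_inj => /=.
    by case: (ltngtP b c') => // lt;
      [have := @T_lt b c' | have := @T_lt c' b]; rewrite lt -ec -eb; lia.
- by move=> [i c] a b [].
- move=> [i c] a b /=; split=> [[-> e]|[-> ne]].
    by split=> // -[_]; rewrite e; case: (c).
  split=> //; case: (nth _ _ _) (c) ne => -[] // ne; by case: ne.
Qed.

Lemma eval_word w r j (a b : 'I_(size W).+1) :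
  drop j W = w ++ r -> a = j :> nat -> b = j + size w :> nat ->
  eval run_val (t_word w) a b.
Proof.
elim: w j a => [|d w IHw] j a /= dE aE bE.
  by apply: val_inj; rewrite /= aE bE addn0.
have lt_j : j.+1 < (size W).+1 by have := ltn_ord b; lia.
exists a; first by split=> //; rewrite aE -[j]addn0 -nth_drop dE.
exists (Ordinal lt_j) => /=; first by rewrite aE.
apply: (IHw j.+1) => //; last by rewrite bE addnS.
by rewrite -add1n -drop_drop dE /= drop0.
Qed.

Let T_pre pre R : ws = pre ++ R -> T (size pre) = size q0 + size (flatten pre).
Proof. by move=> wsE; rewrite /T wsE take_size_cat. Qed.

Let T_le i : T i <= size W.
Proof.
rewrite /T /W size_cat leq_add2l -{2}(cat_take_drop i ws) flatten_cat size_cat.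
exact: leq_addr.
Qed.

Let ord_ws i : i <= size ws -> i < (size W).+1.
Proof. by have := size_flatten_geq ws0; rewrite ltnS /W size_cat; lia. Qed.

Lemma eval_run_init (a : 'I_(size W).+1) : a = 0 :> nat ->
  eval run_val (t_init q0) a a.
Proof.
move=> a0; have T0 : T 0 = size q0 by rewrite /T take0 addn0.
have lt_x : T 0 < (size W).+1 by rewrite ltnS T_le.
have hx : run_val (Action 3) (Ordinal lt_x) a by split; rewrite /= a0.
split=> //; exists (Ordinal lt_x).
  by apply: (eval_word (r := flatten ws) (j := 0)); rewrite ?drop0.
exists (Ordinal lt_x) => //; split=> //; exists a => //; split; rewrite /= a0.
Qed.

Lemma eval_run_step pre w R q (a b : 'I_(size W).+1) :
  ws = pre ++ w :: R -> drop (size pre) W = q ++ flatten (w :: R) ->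
  a = size pre :> nat -> b = (size pre).+1 :> nat ->
  eval run_val (t_step w) a b.
Proof.
move=> wsE dE aE bE.
have le_pre : (size pre).+1 <= size ws by rewrite wsE size_cat /=; lia.
have Ti := T_pre wsE.
have Tj : T (size pre).+1 = T (size pre) + size w.
  rewrite Ti -addnA -size_cat -flatten_rcons -(size_rcons pre w).
  by apply: (T_pre (R := R)); rewrite cat_rcons.
(* The end of the queue lies [size q] beyond its head, by comparing the lengths in [dE]. *)
have Tq : T (size pre) = size pre + size q.
  have := congr1 size dE; rewrite size_drop !size_cat Ti.
  by have := size_flatten_geq ws0; rewrite /W wsE !flatten_cat !size_cat /=; lia.
have lt_x : T (size pre) < (size W).+1 by rewrite ltnS T_le.
have lt_y : T (size pre).+1 < (size W).+1 by rewrite ltnS T_le.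
pose x := Ordinal lt_x; pose y := Ordinal lt_y.
have tax : run_val (Action 2) a x by split; rewrite /= aE // ltnW.
have tby : run_val (Action 2) b y by split; rewrite /= bE.
have hyb : run_val (Action 3) y b by split; rewrite /= bE.
have nab : run_val (Action 0) a b by rewrite /= bE aE.
have pba : run_val (Action 1) b a by rewrite /= bE aE.
exists a => //; split=> //; exists x => //; exists y.
  apply: (eval_word (r := flatten R) (j := T (size pre))) => //.
  by rewrite Tq addnC -drop_drop dE drop_size_cat.
exists y; first by split=> //; exists b.
exists b => //; exists b => //; split=> //; by exists a.
Qed.

(** [pre] lists the words enqueued so far and [R] those still to come: read from the current head,
    [W] is the queue followed by all future words. Both are arbitrary because a subprogram starts
    and ends in mid-run. *)
Lemma eval_run P q ws1 q' : qexec P q ws1 q' ->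
  forall pre R (a b : 'I_(size W).+1),
  ws = pre ++ ws1 ++ R -> drop (size pre) W = q ++ flatten (ws1 ++ R) ->
  a = size pre :> nat -> b = size (pre ++ ws1) :> nat ->
  eval run_val (t_prog P) a b /\ drop (size (pre ++ ws1)) W = q' ++ flatten R.
Proof.
have bit d q1 (pre : seq (seq bool)) (c : 'I_(size W).+1) :
    drop (size pre) W = d :: q1 -> c = size pre :> nat ->
    eval run_val (t_bit d) c c.
  by move=> dE cE; split=> //; rewrite cE -[size pre]addn0 -nth_drop dE.
elim=> {P q ws1 q'} [q|w d q|P1 P2 q1 ws1 q2 ws2 q3 _ IH1 _ IH2|P q
  |P q ws1 q1 ws2 q2 _ IH1 _ IH2] pre R a b wsE dE aE bE.
- by rewrite cats0 in bE *; split=> //; apply: val_inj; rewrite /= aE bE.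
- split.
    apply: (eval_run_step (pre := pre) (q := d :: q) wsE dE aE).
    by rewrite bE size_cat addn1.
  by rewrite size_cat addn1 -add1n -drop_drop dE /= drop0 -catA.
- have lt_c : size (pre ++ ws1) < (size W).+1.
    by apply: ord_ws; rewrite wsE !size_cat; lia.
  rewrite -catA in wsE dE; rewrite catA in bE.
  have [e1 d1] := IH1 pre (ws2 ++ R) a (Ordinal lt_c) wsE dE aE erefl.
  rewrite catA in wsE.
  have [e2 d2] := IH2 (pre ++ ws1) R (Ordinal lt_c) b wsE d1 erefl bE.
  by rewrite catA; split=> //; exists (Ordinal lt_c).
- rewrite cats0 in bE *; split=> //.
  have e : a = b by apply: val_inj; rewrite /= aE bE.
  rewrite -e; exists a; last exact: bit dE aE.
  exact: rt_refl.
- have lt_c : size (pre ++ ws1) < (size W).+1.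
    by apply: ord_ws; rewrite wsE !size_cat; lia.
  rewrite -catA in wsE dE; rewrite catA in bE.
  have [e1 d1] := IH1 pre (ws2 ++ R) a (Ordinal lt_c) wsE dE aE erefl.
  rewrite catA in wsE.
  have [e2 d2] := IH2 (pre ++ ws1) R (Ordinal lt_c) b wsE d1 erefl bE.
  rewrite catA; split=> //.
  have [c ec eb] := e2; exists c => //; apply: rt_trans ec; apply: rt_step.
  by exists a => //; apply: bit dE aE.
Qed.
End Completeness.

Lemma words_cq N P : [::] \notin words (cq N P).
Proof.
suff al : all (predC1 [::]) (words (cq N P)).
  by apply/negP => /(allP al).
have rot k : all (predC1 [::]) (words (qpow k qrot)).
  by elim: k.
elim: P => [|i|P1 IH1 P2 IH2|i P IHP] //=.
- by do ?rewrite !(all_cat, rot) /=.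
- by rewrite all_cat IH1.
- by do ?rewrite !(all_cat, rot, IHP) /=.
Qed.

(** * The search for a counterexample *)

(* Registers 0 and 1 hold x and y, register 2 tells whether R vanished on all
   the pairs tested so far. *)
Definition search_body PR :=
  CSeq PR (CSeq (CInc 1) (CSeq (CInc 2) (CLoop 3 (czero 2)))).

Definition search PR := CSeq (CInc 2) (CLoop 2 (search_body PR)).

(** The input enters as [x] increments in the program text, so the code of the resulting term is an
    iteration of pairing, visibly recursive in [x]. *)
Definition search_from PR x := iter x (CSeq (CInc 0)) (search PR).

Section Search.
Variables (R : 2.-tuple nat -> nat) (PR : cprog).
Hypothesis PRP : computes R (fun i => i) 3 PR.

Lemma cexec_search_body s : s 2 = 0 ->
  exists2 s', cexec (search_body PR) s s' &
    [/\ s' 0 = s 0, s' 1 = (s 1).+1 & s' 2 = (R [tuple s 0; s 1] == 0)].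
Proof.
move=> s2; have [|s1 [ex1 ag1 s1R]] := PRP (s := s) (x := [tuple s 0; s 1]).
  by case=> [[|[|]]].
set s3 := upd (upd s1 1 (s1 1).+1) 2 (upd s1 1 (s1 1).+1 2).+1.
set r := R _ in s1R *.
pose I k (s' : cstate) := [/\ s' 3 = k, k <= r, s' 0 = s 0, s' 1 = (s 1).+1
  & s' 2 = (k == r)].
have [s' ex [s'3 _ s'0 s'1 s'2]] : exists2 s', cexec (CLoop 3 (czero 2)) s3 s' & I 0 s'.
  apply: (@cexec_loop_inv _ _ I _ _ r).
  - by move=> s' [].
  - move=> k s' [s'3 le_k s'0 s'1 s'2]; rewrite s'3; split=> //=.
    have [s'' ex [s''2 s''q]] := cexec_zero 2 (upd s' 3 k).
    exists s'' => //; split; [by rewrite s''q | exact: ltnW | by rewrite s''q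
      | by rewrite s''q | by rewrite s''2 ltn_eqF].
  - by split; rewrite // /s3 /upd /= ?eqxx ag1 // s2.
exists s'; last by rewrite eq_sym s'2.
apply: cexec_seq ex1 _; apply: cexec_seq; first exact: cexec_inc.
by apply: cexec_seq ex; apply: cexec_inc.
Qed.

Lemma cexec_search_from x s y : s 1 = 0 -> s 2 = 0 ->
  R [tuple s 0 + x; y] != 0 -> exists s', cexec (search_from PR x) s s'.
Proof.
elim: x s => [|x IHx] s s1 s2 Ry; last first.
  have [||//|s' ex] := IHx (upd s 0 (s 0).+1) => //; first by rewrite addSnnS.
  by exists s'; apply: cexec_seq ex; apply: cexec_inc.
rewrite addn0 in Ry.
case: (ex_minnP (P := fun y => R [tuple s 0; y] != 0)) => [|m Rm min].
  by exists y.
(* The variant counts the rounds left up to the least counterexample [m], at which register 2 falls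
   to 0. *)
pose I k (s' : cstate) :=
  s' 0 = s 0 /\ if k is 0 then s' 2 = 0 else s' 2 = 1 /\ s' 1 + k = m.+1.
have [|||s' ex _] := @cexec_loop_inv 2 (search_body PR) I _ _ m.+1 (upd s 2 (s 2).+1).
- by move=> s' [].
- move=> k s' [s'0 [s'2 s'1]]; rewrite s'2; split=> //.
  have [//|s'' ex [s''0 s''1 s''2]] := @cexec_search_body (upd s' 2 0).
  exists s'' => //; split; first by rewrite s''0.
  move: s''2; rewrite /upd /= s'0 => s''2.
  case: k s'1 => [|k] s'1.
    by rewrite s''2; have -> : s' 1 = m; [lia | rewrite (negPf Rm)].
  rewrite s''2 s''1 /upd /=; split; last by lia.
  by case: eqP => // /eqP /min; lia.
- by rewrite /I /upd /= s1 s2.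
by exists s'; apply: cexec_seq ex; apply: cexec_inc.
Qed.

Lemma search_from_diverges N x s l q : regs_below N (search PR) -> 0 < N ->
  represents N s l -> s 1 = 0 -> s 2 = 0 ->
  (forall y, R [tuple s 0 + x; y] = 0) ->
  ~ run (cq N (search_from PR x)) (unary l) q.
Proof.
move=> reg N0; elim: x s l => [|x IHx] s l rep s1 s2 R0 /run_seq_inv[q1 run1 run2].
  have lt_2 : 2 < N by case/andP: reg.
  have [l1 run1' rep1] := cexec_simulates (cexec_inc 2 s) lt_2 rep.
  rewrite (run_det run1 run1') in run2.
  pose I (s' : cstate) := s' 0 = s 0 /\ s' 2 = 1.
  apply: (@loop_diverges N 2 (search_body PR) I _ _ _ _ _ _ rep1 _ run2) => //.
  - by case/and3P: reg.
  - move=> s' [s'0 s'2]; exists 0 => //.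
    have [//|s'' ex [s''0 s''1 s''2]] := @cexec_search_body (upd s' 2 0).
    exists s'' => //; split; first by rewrite s''0.
    by rewrite s''2 /upd /= s'0 -(addn0 (s 0)) R0.
  - by rewrite /I /upd /= s2.
have [l1 run1' rep1] := cexec_simulates (cexec_inc 0 s) N0 rep.
rewrite (run_det run1 run1') in run2.
by apply: IHx rep1 _ _ _ run2 => // y; rewrite /upd /= addSnnS.
Qed.
End Search.

(** * The reduction *)

Definition search_term N PR x :=
  TSeq (t_init (unary (nseq N.*2 0))) (t_prog (cq N (search_from PR x))).

Lemma represents0 N : represents N (fun _ => 0) (nseq N.*2 0).
Proof. by split=> [|i _]; rewrite ?size_nseq // nth_nseq if_same. Qed.

(** A positive [N] puts a bit into the initial queue, so the primitive test does occur and the count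
    is one, not zero. *)
Lemma fragment_search_term N PR x : 0 < N -> fragment (search_term N PR x).
Proof.
move=> N0; apply: (fragment_allowed (p := 0)).
- by apply: PWP_seq; [apply: PWP_init | apply: PWP_prog].
- by rewrite /= all_cat allowed_init allowed_prog.
- by case: N N0.
Qed.

(** A counterexample makes the search halt, and the halting run is a model; conversely a related
    pair in any model would yield a finite run of a diverging search. *)
Lemma search_term_empty R PR N x :
  computes R (fun i => i) 3 PR -> regs_below N (search PR) -> 0 < N ->
  term_empty DREL_test (search_term N PR x) <-> forall y, R [tuple x; y] = 0.
Proof.
move=> PRP reg N0; split=> [emp y|R0 B v vP a b].
  apply/eqP; apply/negPn/negP => Ry.
  have [//|//|s' ex] := cexec_search_from PRP (s := fun _ => 0) _ _ Ry.
  have regx z : regs_below N (search_from PR z) by elim: z => //= z ->; rewrite N0.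
  have [l [ws run] _] := cexec_simulates ex (regx x) (represents0 N).
  have ws0 : [::] \notin ws.
    by apply/negP => /(qexec_words run); apply/negP/words_cq.
  set q0 := unary _ in run.
  have lt_b : size ws < (size (q0 ++ flatten ws)).+1.
    by rewrite ltnS size_cat; have := size_flatten_geq ws0; lia.
  have [||||ev _] := eval_run ws0 run (pre := [::]) (R := [::])
    (a := ord0) (b := Ordinal lt_b).
  - by rewrite cats0.
  - by rewrite drop0 cats0.
  - by [].
  - by [].
  apply: (emp _ _ (run_val_DREL q0 ws0) ord0 (Ordinal lt_b)).
  by exists ord0 => //; apply: eval_run_init.
move=> [c ei ep]; have [e ha] := eval_init vP ei; rewrite -e in ep.
have q0 : unary (nseq N.*2 0) != [::] by case: (N) N0.
have [q [run _ _]] := eval_prog vP ep (words_cq _ _) ha q0.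
exact: (search_from_diverges PRP reg N0 (represents0 N) _ _ R0 run).
Qed.

Lemma term_code_seq t u :
  term_code (TSeq t u) = npair 4 (npair (term_code t) (term_code u)).
Proof. by []. Qed.

Lemma term_code_search N PR x :
  term_code (search_term N PR x) =
    npair 4 (npair (term_code (t_init (unary (nseq N.*2 0))))
      (iter x (fun c => npair 4 (npair (term_code (t_prog (cq N (CInc 0)))) c))
         (term_code (t_prog (cq N (search PR)))))).
Proof.
rewrite /search_term term_code_seq; set c0 := term_code (t_init _).
suff -> : term_code (t_prog (cq N (search_from PR x))) = iter x
    (fun c => npair 4 (npair (term_code (t_prog (cq N (CInc 0)))) c))
    (term_code (t_prog (cq N (search PR)))) by reflexivity.
elim: x => [|x IHx]; first reflexivity.
have -> : t_prog (cq N (search_from PR x.+1)) =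
  TSeq (t_prog (cq N (CInc 0))) (t_prog (cq N (search_from PR x))) by reflexivity.
rewrite [RHS]iterS -IHx; exact: term_code_seq.
Qed.

Lemma recursive_search_term N PR :
  recursive (fun x : 1.-tuple nat => term_code (search_term N PR (thead x))).
Proof.
have R0 : rec 1 (fun s => nth 0 s 0) by exact: rec_var.
have Rc c0 c1 c2 : rec 1 (fun s =>
    npair 4 (npair c0 (iter (nth 0 s 0) (fun k => npair 4 (npair c1 k)) c2))).
  by rec_tac.
apply: rec_ext (Rc (term_code (t_init (unary (nseq N.*2 0))))
  (term_code (t_prog (cq N (CInc 0)))) (term_code (t_prog (cq N (search PR))))) => x.
by rewrite -(tnth_nth 0 x ord0) term_code_search.
Qed.

Lemma fragment_emptiness_hard Q :
  Pi01 Q -> many_one_reducible Q (emptiness_problem DREL_test fragment).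
Proof.
move=> [R Rrec QP].
have [|PR PRP] := recursive_computable Rrec (ins := fun i => i) (F := 3).
  by move=> i; apply: leq_trans (ltn_ord i) _.
have [N0 reg] := regs_below_exists (search PR).
(* The successor makes [N] positive. *)
pose N := N0.+1; have {}reg : regs_below N (search PR) by apply: reg.
exists (fun x => term_code (search_term N PR (thead x))).
  exact: recursive_search_term.
move=> x; rewrite QP -(search_term_empty _ PRP reg) //; split=> [emp|[t [e _ emp]]].
  by exists (search_term N PR x); split=> //; apply: fragment_search_term.
by rewrite -(term_code_inj e) in emp.
Qed.

Lemma Pi01_complete_ext P P' :
  (forall n, P n <-> P' n) -> Pi01_complete P -> Pi01_complete P'.
Proof.
move=> e [[R Rrec RP] hard]; split.
  by exists R => // x; rewrite -e.
by move=> Q /hard[f frec fP]; exists f => // x; rewrite -e.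
Qed.

Theorem theorem44 :
  let T (t : term) : Prop :=
    [/\ PWP_loop t, num_actions t <= 4 & num_ptests t = 1] in
  Pi01_complete (emptiness_problem DREL_test T) /\
  Pi01_complete (emptiness_problem DREL_fin_test T).
Proof.
have complete : Pi01_complete (emptiness_problem DREL_test fragment).
  split; [exact: Pi01_fragment_emptiness | exact: fragment_emptiness_hard].
split=> //; apply: Pi01_complete_ext complete => n.
by split=> -[t [nE Tt emp]]; exists t; split=> //; apply/term_empty_DREL_fin.
Qed.
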